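(* Let $N\ge1$, let $\Omega$ be any smooth (possibly unbounded) domain of $\mathbb{R}^N$, $p>1$ and $u_0\in L^\infty(\Omega)$. Let $u$ be the maximal classical solution of $$u_t=\Delta u+|u|^{p-1}u \ \ (t>0,\ x\in\Omega),\qquad u=0\ \ (t>0,\ x\in\partial\Omega),\qquad u(0,x)=u_0(x)\ \ (x\in\Omega),$$ with maximal existence time $T$. Assume that $u$ is a blow-up solution ($T<\infty$) satisfying the type I estimate $$\|u(t)\|_{L^\infty(\Omega)}\le M(T-t)^{-1/(p-1)},\qquad 0\le t<T,$$ with $M>0$. Then there exist $\eta_1,k_1>0$, depending only on $M,p,N$, such that for any blow-up point $a\in\overline\Omega$ of $u$, we have $$\int_{\Omega\cap\{|x-a|\le k_1\sqrt{T-t}\}}|u(t,x)|^{q^*}\,dx\ge\eta_1,\qquad 0\le t<T,$$ where $q^*=N(p-1)/2$.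
   Context: For any $u_0\in L^\infty(\Omega)$ the problem has a unique, maximal classical (real-valued, possibly sign-changing) solution $u$; $T=T(u_0)\in(0,\infty]$ denotes its maximal existence time, and if $T<\infty$ then $\lim_{t\to T}\|u(t)\|_{L^\infty(\Omega)}=\infty$ (blow-up). If $\Omega=\mathbb{R}^N$ the boundary condition is void. The exponent $q^*$ may be less than $1$. A point $a\in\overline\Omega$ is a blow-up point of $u$ if $\limsup_{t\to T,\,x\to a}|u(t,x)|=\infty$. *)

(* Defs.v *)
From HB Require Import structures.
From mathcomp Require Import all_boot all_order all_algebra.
From mathcomp Require Import all_classical all_reals all_analysis.

Set Implicit Arguments.
Unset Strict Implicit.
Unset Printing Implicit Defensive.

Import Order.TTheory GRing.Theory Num.Theory.
Import numFieldNormedType.Exports.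

Local Open Scope classical_set_scope.
Local Open Scope ring_scope.

Definition rV_display : measure_display.
Proof. exact: default_measure_display. Qed.

Section measurable_rV.
Context {R : realType} (n : nat).

Let coor : 'I_n -> 'rV[R]_n -> measurableTypeR R := fun i x => x ord0 i.

Let rV_set0 : g_sigma_preimage coor set0.
Proof. exact: sigma_algebra0. Qed.

Let rV_setC A : g_sigma_preimage coor A -> g_sigma_preimage coor (~` A).
Proof. exact: sigma_algebraC. Qed.

Let rV_bigcup (F : _^nat) : (forall i, g_sigma_preimage coor (F i)) ->
  g_sigma_preimage coor (\bigcup_i (F i)).
Proof. exact: sigma_algebra_bigcup. Qed.

(* The product of n copies of the Borel sigma-algebra of R, that is, the Borel
   sigma-algebra of R^n. *)
HB.instance Definition _ := @isMeasurable.Build rV_display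
  'rV[R]_n (g_sigma_preimage coor) rV_set0 rV_setC rV_bigcup.

Lemma measurable_coord (i : 'I_n) :
  measurable_fun [set: 'rV[R]_n] (fun x : 'rV[R]_n => x ord0 i).
Proof.
move=> _ Y mY; rewrite setTI; apply: sub_sigma_algebra => /=.
rewrite -bigcup_seq/=; exists i => /=; first by rewrite mem_index_enum.
by exists Y => //; rewrite setTI.
Qed.

Lemma measurable_fun_rVP d (T : measurableType d) (f : T -> 'rV[R]_n) :
  measurable_fun [set: T] f <->
  forall i, measurable_fun [set: T] (fun x => f x ord0 i).
Proof.
split=> [mf i|mf]; first exact: measurableT_comp (measurable_coord i) mf.
suff: g_sigma_preimage (fun i => coor i \o f) `<=` measurable.
  by rewrite g_sigma_preimage_comp => H _ A mA; apply: H; exists A.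
apply: smallest_sub; first exact: sigma_algebra_measurable.
rewrite -bigcup_seq/=; apply: bigcup_sub => i _ A [B mB <-]; exact: mf.
Qed.

End measurable_rV.

Section lebesgue_rV.
Context {R : realType}.

Definition rV_cons n (z : measurableTypeR R * 'rV[R]_n) : 'rV[R]_n.+1 :=
  row_mx (\row_(_ < 1) (z.1 : R)) z.2.

Lemma rV_cons0 n z : @rV_cons n z ord0 ord0 = z.1.
Proof.
have -> : ord0 = lshift n (ord0 : 'I_1) by exact/val_inj.
by apply: (eq_trans (row_mxEl _ _ _ _)); rewrite mxE.
Qed.

Lemma rV_consS n z i : @rV_cons n z ord0 (lift ord0 i) = z.2 ord0 i.
Proof.
have -> : lift ord0 i = rshift 1 i by exact/val_inj.
exact: row_mxEr.
Qed.

Lemma measurable_rV_cons n : measurable_fun setT (@rV_cons n).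
Proof.
apply/measurable_fun_rVP => i; case: (unliftP ord0 i) => [j|] ->.
- under eq_fun do rewrite rV_consS.
  exact: measurableT_comp (measurable_coord j) measurable_snd.
- under eq_fun do rewrite rV_cons0.
  exact: measurable_fst.
Qed.

Definition rV_uncons n (x : 'rV[R]_n.+1) : measurableTypeR R * 'rV[R]_n :=
  (x ord0 ord0, \row_i x ord0 (lift ord0 i)).

Lemma rV_consK n : cancel (@rV_cons n) (@rV_uncons n).
Proof.
move=> [t x]; congr (_, _) => /=; first by rewrite rV_cons0.
by apply/rowP => i; rewrite mxE rV_consS.
Qed.

Lemma measurable_rV_uncons n : measurable_fun setT (@rV_uncons n).
Proof.
apply/measurable_fun_pairP; split => /=; first exact: measurable_coord.
apply/measurable_fun_rVP => i /=.
by under eq_fun do rewrite mxE; exact: measurable_coord.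
Qed.

HB.instance Definition _ n := isMeasurableFun.Build _ _ _ _ (@rV_cons n)
  (@measurable_rV_cons n).

Section step.
Variables (n : nat) (mu : {sigma_finite_measure set 'rV[R]_n -> \bar R}).

Definition lebesgue_rV_step : set 'rV[R]_n.+1 -> \bar R :=
  pushforward (@lebesgue_measure R \x mu)%E (@rV_cons n).

Let step0 : lebesgue_rV_step set0 = 0%E. Proof. exact: measure0. Qed.

Let step_ge0 A : (0 <= lebesgue_rV_step A)%E. Proof. exact: measure_ge0. Qed.

Let step_sigma_additive : semi_sigma_additive lebesgue_rV_step.
Proof. exact: measure_semi_sigma_additive. Qed.

HB.instance Definition _ := isMeasure.Build _ _ _ lebesgue_rV_step
  step0 step_ge0 step_sigma_additive.

Let step_sigma_finite : sigma_finite setT lebesgue_rV_step.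
Proof.
have /sigma_finiteP[F [FT ndF Foo]] := sigma_finiteT (@lebesgue_measure R).
have /sigma_finiteP[G [GT ndG Goo]] := sigma_finiteT mu.
exists (fun k => @rV_uncons n @^-1` (F k `*` G k)).
  apply/esym; rewrite -subTset => x _.
  have [i _ Fi] : (\bigcup_k F k) (rV_uncons x).1 by rewrite -FT.
  have [j _ Gj] : (\bigcup_k G k) (rV_uncons x).2 by rewrite -GT.
  exists (maxn i j) => //; split => /=.
  - by move: Fi; exact/subsetPset/ndF/leq_maxl.
  - by move: Gj; exact/subsetPset/ndG/leq_maxr.
move=> k; have [mF Fk] := Foo k; have [mG Gk] := Goo k; split.
  by rewrite -[X in measurable X]setTI; apply: measurable_rV_uncons => //;
    exact: measurableX.
rewrite /lebesgue_rV_step /pushforward -comp_preimage.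
rewrite (_ : _ \o _ = id) ?preimage_id; last first.
  by apply/funext => z; exact: rV_consK.
by rewrite product_measure1E// lte_mul_pinfty// ge0_fin_numE.
Qed.

HB.instance Definition _ := Measure_isSigmaFinite.Build _ _ _ lebesgue_rV_step
  step_sigma_finite.

End step.

Fixpoint lebesgue_rV n : {sigma_finite_measure set 'rV[R]_n -> \bar R} :=
  if n is n'.+1 then lebesgue_rV_step (lebesgue_rV n') else \d_(0 : 'rV[R]_0).

Lemma lebesgue_rV_box n (A : 'I_n -> set (measurableTypeR R)) :
  (forall i, measurable (A i)) ->
  lebesgue_rV n [set x | forall i, A i (x ord0 i)] =
  (\prod_i lebesgue_measure (A i))%E.
Proof.
elim: n A => [|n IHn] A mA /=.
  by rewrite big_ord0 diracE mem_set// => -[].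
rewrite big_ord_recl -(IHn (A \o lift ord0))//; last by move=> i; exact: mA.
have mB : measurable [set x : 'rV[R]_n | forall i, A (lift ord0 i) (x ord0 i)].
  rewrite (_ : mkset _ =
      \bigcap_i ((fun x : 'rV[R]_n => x ord0 i) @^-1` A (lift ord0 i))).
    apply: fin_bigcap_measurable => [|i _]; first exact: finite_finset.
    by rewrite -[X in measurable X]setTI; apply: measurable_coord => //; exact: mA.
  by apply/seteqP; split=> x h i; [move=> _|]; exact: h.
rewrite -product_measure1E// /lebesgue_rV_step /pushforward.
congr ((_ \x _)%E _); apply/seteqP; split => -[t x] /= h.
  split => /= [|i]; first by have := h ord0; rewrite rV_cons0.
  by have := h (lift ord0 i); rewrite rV_consS.
move=> i; case: (unliftP ord0 i) => [j|] ->; first by rewrite rV_consS; exact: h.2.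
by rewrite rV_cons0; exact: h.1.
Qed.

End lebesgue_rV.

Section domains.
Context {R : realType} {N : nat}.
Implicit Types (Omega : set 'rV[R]_N).

(* The norm `|x| of the library on 'rV[R]_N is the sup norm. *)
Definition enorm (x : 'rV[R]_N) : R := Num.sqrt (\sum_i x ord0 i ^+ 2).

Definition partial n (i : 'I_n) (f : 'rV[R]_n -> R) : 'rV[R]_n -> R :=
  'D_(delta_mx ord0 i) f.

Definition laplacian (f : 'rV[R]_N -> R) (x : 'rV[R]_N) : R :=
  \sum_i partial i (partial i f) x.

Fixpoint Ck n (k : nat) (f : 'rV[R]_n -> R) : Prop :=
  continuous f /\
  (if k is k'.+1 then
     forall i, (forall x, derivable f x (delta_mx ord0 i)) /\ Ck k' (partial i f)
   else True).

Definition Cinfty n (f : 'rV[R]_n -> R) : Prop := forall k, Ck k f.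

Definition domain Omega : Prop :=
  [/\ open Omega, connected Omega & Omega !=set0].

Definition boundary Omega : set 'rV[R]_N := closure Omega `\` interior Omega.

(* Near each boundary point, after relabelling (choice of i) and reorienting
   (choice of s) the coordinate axes, Omega lies on one side of the graph of a
   smooth function of the other N - 1 coordinates col' i x. *)
Definition smooth_boundary Omega : Prop :=
  forall a, boundary Omega a ->
  exists (i : 'I_N) (s : bool) (g : 'rV[R]_N.-1 -> R), Cinfty g /\
    \forall x \near a,
      Omega x <-> 0 < (-1) ^+ s * (x ord0 i - g (col' i x)).

End domains.

Section semilinear_heat_equation.
Context {R : realType} {N : nat}.
Implicit Types (p : R) (Omega : set 'rV[R]_N) (T : \bar R).
Implicit Types (u : R -> 'rV[R]_N -> R) (x : 'rV[R]_N).

Definition Linfty Omega : set ('rV[R]_N -> R) :=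
  [set f | (f \_ Omega) \in Lfun (lebesgue_rV N) +oo%E].

Definition Linfty_norm Omega (f : 'rV[R]_N -> R) : \bar R :=
  Lnorm (lebesgue_rV N) +oo%E (EFin \o (f \_ Omega)).

(* u, u_t and the first and second order derivatives of u in x exist and are
   jointly continuous on ]0, T[ x Omega. *)
Definition C12 T Omega u : Prop :=
  forall (t : R) x, 0 < t -> (t%:E < T)%E -> Omega x ->
  [/\ {for (t, x), continuous (fun z : R * 'rV[R]_N => u z.1 z.2)},
      derivable (u ^~ x) t 1,
      {for (t, x), continuous (fun z : R * 'rV[R]_N => derive1 (u ^~ z.2) z.1)},
      forall i, derivable (u t) x (delta_mx ord0 i) /\
        {for (t, x), continuous (fun z : R * 'rV[R]_N => partial i (u z.1) z.2)} &
      forall i j, derivable (partial i (u t)) x (delta_mx ord0 j) /\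
        {for (t, x), continuous
           (fun z : R * 'rV[R]_N => partial j (partial i (u z.1)) z.2)}].

(* Classical solution on [0, T[ of
     u_t = Delta u + |u|^(p-1) u in Omega, u = 0 on the boundary, u(0) = u0.
   For a merely bounded u0 the initial datum cannot be attained uniformly: u is
   bounded on [0, tau] x Omega for every tau < T, and u(t) --> u0 in
   L^1_loc(closure Omega) as t --> 0+. *)
Record classical_solution p Omega (u0 : 'rV[R]_N -> R) T u : Prop := ClassicalSolution {
  cs_T : (0 < T)%E;
  cs_C12 : C12 T Omega u;
  cs_continuous : {within [set z | [/\ 0 < z.1, (z.1%:E < T)%E & closure Omega z.2]],
    continuous (fun z : R * 'rV[R]_N => u z.1 z.2)};
  cs_equation : forall (t : R) x, 0 < t -> (t%:E < T)%E -> Omega x ->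
    derive1 (u ^~ x) t = laplacian (u t) x + `|u t x| `^ (p - 1) * u t x;
  cs_boundary : forall (t : R) x, 0 < t -> (t%:E < T)%E -> boundary Omega x ->
    u t x = 0;
  cs_initial : forall x, Omega x -> u 0 x = u0 x;
  cs_bounded : forall tau : R, (tau%:E < T)%E -> exists B : R,
    forall t : R, 0 <= t <= tau -> (Linfty_norm Omega (u t) <= B%:E)%E;
  cs_initial_L1loc : forall r : R,
    (\int[lebesgue_rV N]_(x in Omega `&` [set x | (enorm x <= r)%R])
        `|u t x - u0 x|%:E)%E @[t --> 0^'+] --> 0%E }.

Definition maximal_classical_solution p Omega (u0 : 'rV[R]_N -> R) T u : Prop :=
  classical_solution p Omega u0 T u /\
  forall T' v, classical_solution p Omega u0 T' v ->
    (forall (t : R) x, 0 <= t -> (t%:E < T)%E -> Omega x -> v t x = u t x) ->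
    (T' <= T)%E.

Definition blowup_point Omega (T : R) u (a : 'rV[R]_N) : Prop :=
  closure Omega a /\
  limf_esup (fun z : R * 'rV[R]_N => `|u z.1 z.2|%:E)
    (within [set z | 0 < z.1 < T /\ Omega z.2] (nbhs (T, a))) = +oo%E.

End semilinear_heat_equation.

(* Main.v *)
Require Import Defs.
From mathcomp Require Import all_boot all_order all_algebra.
From mathcomp Require Import all_classical all_reals all_analysis.
From mathcomp Require Import measurable_realfun ess_sup_inf ring lra.
Set Implicit Arguments.
Unset Strict Implicit.
Unset Printing Implicit Defensive.
Import Order.TTheory GRing.Theory Num.Theory.
Import numFieldNormedType.Exports.
Local Open Scope classical_set_scope.
Local Open Scope ring_scope.

(** Extend [|u|] by zero outside [Omega]: it is continuous and, where positive, a
    subsolution of [U_t = Delta U + U^p].  Rescale so that [a] becomes the origin,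
    the time [t] becomes [0] and the blow-up time becomes [1]; the scaling leaves
    the integral of [U^q] with [q = N (p - 1) / 2] and the constant [M] invariant.
    On [[0, 1/2]] the nonlinearity is bounded by a multiple of [U], and a barrier
    made of finitely many Gaussians shows that a small integral of [U^q] at time
    [0] makes [U] uniformly small near the origin at time [1/2].  On [[1/2, 1[] a
    barrier [e (1 + t) + e' |x - b|^(2 n + 2) (1 - t)^(-n)], whose second term
    beats the type I rate away from [b], keeps [U] bounded near the origin, so
    that [a] is not a blow-up point.  All comparisons are first-touching arguments
    on compact cylinders.  The time [t = 0], where the datum is only attained in
    [L^1_loc], follows by letting [t] tend to [0], at the price of a factor [2]. *)

(** Constants depending on [M], [p] and [N] alone call for a comparison that never sees the geometry
    of [Omega]: after extension by zero it takes place on the whole space at unit scale. The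
    extension may have corners on the zero set of [u] and on the boundary, so subsolutions are
    tested by difference quotients, and only where [U > 0]; the barriers are positive, so no
    touching occurs elsewhere. The exponent [q] may be below [1], which rules out Hoelder or Jensen
    between [U^q] and the heat kernel; instead, up to time 1/2 the type I bound confines [U] to a
    bounded range, where [U <= d + C U^q] for any [q > 0]. After time 1/2 the potential [U^(p-1)]
    may be as large as [M^(p-1) / (1 - t)], critical in similarity variables, and [M] is not small.
    The free exponent [n] of the barrier beats it: differentiating [(1 - t)^(-n)] gains the factor
    [n / (1 - t)]. The price is a barrier that dominates the type I rate only at a large distance
    [r], so smallness at time 1/2 is needed on a large box, and the integral is controlled on a
    still larger one. *)

(** * First and second order expansions on the line *)

Section calculus.
Context {R : realType}.
Implicit Types (f g : R -> R) (a b c e d h x : R).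

Lemma near0P (P : R -> Prop) :
  (\forall h \near 0, P h) <-> exists2 d : R, 0 < d & forall h, `|h| < d -> P h.
Proof.
split.
  move=> /nbhs_ballP[d d0 Pd]; exists d => // h hd.
  by apply: Pd; rewrite /ball /= sub0r normrN.
move=> [d d0 Pd]; apply/nbhs_ballP; exists d => // h.
by rewrite /ball /= sub0r normrN; exact: Pd.
Qed.

Lemma is_derive_epsilon f a c e : is_derive a 1 f c -> 0 < e ->
  exists2 d : R, 0 < d & forall h, `|h| < d -> `|f (a + h) - f a - c * h| <= e * `|h|.
Proof.
move=> [df fc] e0.
have := df; rewrite /derivable => /cvg_ex[l fl].
have lc : l = c by rewrite -fc; apply/esym; apply: cvg_lim => //.
move: fl => /cvgrPdist_le/(_ _ e0).
rewrite near_withinE => /near0P[d d0 H]; exists d => // h hd.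
have [->|h0] := eqVneq h 0; first by rewrite addr0 subrr mulr0 subrr normr0 mulr0.
have := H h hd h0; rewrite lc /= /shift /=.
rewrite -[_ *: _]/(_ * _) -[h *: 1]/(h * 1) mulr1 (addrC h a) => H1.
rewrite -ler_pdivrMr ?normr_gt0// -normfV -normrM.
have -> // : (f (a + h) - f a - c * h) / h = h^-1 * (f (a + h) - f a) - c by field.
by rewrite distrC.
Qed.

(** The mean value theorem for [f x + f (- x) - c x^2] reduces the claim to a first-order one: [f']
    only has to be differentiable at [0], with no continuity of a second derivative. *)
Lemma sym_second_difference f f' c e :
  (\forall h \near (0 : R), is_derive h (1 : R) f (f' h)) -> is_derive (0 : R) (1 : R) f' c -> 0 < e ->
  exists2 d : R, 0 < d & forall h, 0 < h < d ->
    `|f h + f (- h) - 2 * f 0 - c * h ^+ 2| <= e * h ^+ 2.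
Proof.
move=> /near0P[d1 d10 H1] f'c e0.
have [d2 d20 H2] := is_derive_epsilon f'c (divr_gt0 e0 (ltr0n _ 2)).
exists (Num.min d1 d2); first by rewrite lt_min d10.
move=> h /andP[h0]; rewrite lt_min => /andP[hd1 hd2].
pose G x := f x + f (- x) - c * x ^+ 2.
pose G' x := f' x - f' (- x) - 2 * c * x.
have GD x : `|x| < d1 -> is_derive x 1 G (G' x).
  move=> xd.
  have fx : is_derive x 1 f (f' x) by exact: H1.
  have fNx : is_derive (- x) 1 f (f' (- x)) by apply: H1; rewrite normrN.
  have fN : is_derive x 1 (f \o -%R) (- f' (- x)).
    apply: is_derive_eq.
    by rewrite mulrN1.
  rewrite /G; apply: is_derive_eq; rewrite /G' /GRing.scale /=.
  by ring.
have hG : {within `[0, h], continuous G}.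
  apply: derivable_within_continuous => x; rewrite in_itv/= => /andP[x0 xh].
  by have /GD[] : `|x| < d1 by rewrite ger0_norm// (le_lt_trans xh).
have [x xI GE] : exists2 x, x \in `]0, h[%R & G h - G 0 = G' x * (h - 0).
  apply: MVT => // x; rewrite in_itv/= => /andP[x0 xh].
  by apply: GD; rewrite gtr0_norm// (lt_trans xh).
move: xI; rewrite in_itv/= => /andP[x0 xh].
have G'x : `|G' x| <= e * x.
  have A := H2 x; have B := H2 (- x).
  rewrite !add0r ?normrN gtr0_norm// in A B.
  have xd2 := lt_trans xh hd2.
  have {}A := A xd2; have {}B := B xd2.
  have -> : G' x = (f' x - f' 0 - c * x) - (f' (- x) - f' 0 - c * - x) by rewrite /G'; ring.
  by apply: le_trans (ler_normB _ _) _; lra.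
have -> : f h + f (- h) - 2 * f 0 - c * h ^+ 2 = G h - G 0.
  by rewrite /G oppr0; ring.
rewrite GE subr0 normrM (gtr0_norm h0) expr2 mulrA ler_pM2r//.
by apply: le_trans G'x _; rewrite ler_pM2l// ltW.
Qed.

End calculus.

(** * Subsolutions and the comparison principle on a compact cylinder *)

Section comparison.
Context {R : realType} {N : nat}.
Implicit Types (U Z : R -> 'rV[R]_N -> R) (t s h r e p : R) (x y b : 'rV[R]_N).

Lemma near_rVP (t : R) x (P : R * 'rV[R]_N -> Prop) :
  (\forall z \near (t, x), P z) <->
  exists2 d : R, 0 < d &
    forall s y, `|s - t| < d -> (forall i, `|y ord0 i - x ord0 i| < d) -> P (s, y).
Proof.
split.
  move=> /nbhs_ballP[d d0 Pd]; exists d => // s y std yxd.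
  apply: Pd; split => /=; first by rewrite /ball/= distrC.
  by split=> // i j; rewrite (ord1 i) /ball /= distrC; exact: yxd.
move=> [d d0 Pd]; apply/nbhs_ballP; exists d => //= -[s y] [/= Hs Hy].
apply: Pd => [|i]; first by rewrite distrC.
by rewrite distrC; exact: Hy.2.
Qed.

Definition jcont U t x := {for (t, x), continuous (fun z : R * 'rV[R]_N => U z.1 z.2)}.

Lemma jcontP U t x : jcont U t x <-> forall e, 0 < e ->
  exists2 d : R, 0 < d & forall s y, `|s - t| < d ->
    (forall i, `|y ord0 i - x ord0 i| < d) -> `|U s y - U t x| < e.
Proof.
split.
  move=> /cvgrPdist_lt H e e0; have /= := H _ e0 => /near_rVP[d d0 {}H].
  by exists d => // s y Hs Hy; rewrite distrC; exact: H.
move=> H; apply/cvgrPdist_lt => e e0; apply/near_rVP.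
have [d d0 {}H] := H _ e0; exists d => // s y Hs Hy /=.
by rewrite distrC; exact: H.
Qed.

Definition box b r : set 'rV[R]_N := [set x | forall i, `|x ord0 i - b ord0 i| <= r].

Lemma box_compact b r : compact (box b r).
Proof.
have := @rV_compact R N (fun i => [set` `[b ord0 i - r, b ord0 i + r]]).
move=> /(_ (fun i => @segment_compact _ _ _)).
congr (compact _); apply/seteqP; split => x /= H i; have := H i.
  by rewrite in_itv/= ler_distl.
by rewrite in_itv/= ler_distl.
Qed.

Notation ei i := (delta_mx ord0 i : 'rV[R]_N).

(* Subsolutions of [u_t = Delta u + u^p], tested with one-sided difference
   quotients in [t] and symmetric second differences in each coordinate. *)
Definition subsolution p U t x := forall (z : R) (c : 'I_N -> R),
  (forall e, 0 < e -> exists2 d : R, 0 < d & forall s, t - d < s < t ->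
     U s x - U t x <= (z - e) * (s - t)) ->
  (forall i e, 0 < e -> exists2 d : R, 0 < d & forall h, 0 < h < d ->
     U t (x + h *: ei i) + U t (x - h *: ei i) - 2 * U t x <= (c i + e) * h ^+ 2) ->
  z <= \sum_i c i + U t x `^ p.

Definition second_differential Z t x (c : 'I_N -> R) := forall i e, 0 < e ->
  exists2 d : R, 0 < d & forall h, 0 < h < d ->
    `|Z t (x + h *: ei i) + Z t (x - h *: ei i) - 2 * Z t x - c i * h ^+ 2| <= e * h ^+ 2.

(* [heat_defect Z t x e] says that [Z_t - Delta Z = e] at [(t, x)]. *)
Definition heat_defect Z t x e := exists (z : R) (c : 'I_N -> R),
  [/\ is_derive t (1 : R) (Z ^~ x) z, second_differential Z t x c & e = z - \sum_i c i].

(** Since [U - Z] vanishes at the touching point and is nonpositive before it and along the axes,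
    increments of [U] are bounded by those of [Z]: the derivatives of [Z] are admissible test data
    for [U]. *)
Lemma touching p U Z t x e (d : R) : subsolution p U t x -> heat_defect Z t x e ->
  U t x = Z t x -> 0 < d -> (forall s, t - d < s < t -> U s x <= Z s x) ->
  (forall i h, `|h| < d -> U t (x + h *: ei i) <= Z t (x + h *: ei i)) ->
  e <= U t x `^ p.
Proof.
move=> subU [z [c [Zz Zc ->]]] UZ d0 Ut Ux; rewrite lerBlDl.
apply: subU => [e' e'0|i e' e'0].
  have [d1 d10 H1] := is_derive_epsilon Zz e'0.
  exists (Num.min d d1); first by rewrite lt_min d0.
  move=> s /andP[sd st].
  have [sd' sd1] : t - d < s /\ t - d1 < s.
    have [] : Num.min d d1 <= d /\ Num.min d d1 <= d1 by split; rewrite ge_min lexx ?orbT.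
    by move=> *; lra.
  have E : `|s - t| = t - s by rewrite ltr0_norm ?opprB// subr_lt0.
  have := H1 (s - t); rewrite E (_ : t + (s - t) = s) ?ler_norml => [H1s|]; last by ring.
  have H : t - s < d1 by lra.
  have /andP[_ ?] := H1s H.
  by have := Ut s; rewrite sd' st => /(_ isT) ?; rewrite UZ mulrBl; lra.
have [d1 d10 H1] := Zc i _ e'0.
exists (Num.min d d1); first by rewrite lt_min d0.
move=> h /andP[h0]; rewrite lt_min => /andP[hd hd1].
have := H1 h; rewrite h0 hd1 => /(_ isT); rewrite ler_norml => /andP[_].
have := Ux i h; rewrite gtr0_norm// => /(_ hd).
have := Ux i (- h); rewrite normrN gtr0_norm// scaleNr => /(_ hd).
by rewrite UZ mulrDl => *; lra.
Qed.

(** [W] is continuous only at the points of [A], so the sublevel set is not known to be closed in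
    the whole space; instead, a cluster point in [A] with [W > 0] is excluded by a neighbourhood
    where [W > 0]. *)
Lemma compact_sublevel (A : set (R * 'rV[R]_N)) (W : R * 'rV[R]_N -> R) :
  compact A -> (forall z, A z -> {for z, continuous W}) ->
  compact (A `&` [set z | W z <= 0]).
Proof.
move=> cA cW F PF FA.
have [z [Az Fz]] := cA F PF (filterS (@subIsetl _ _ _) FA).
exists z; split => //; split => //=; rewrite leNgt; apply/negP => Wz.
have : \forall y \near z, 0 < W y by apply: (cvgr_gt _ (cW z Az)).
move=> /(Fz _ _ FA)[y [[_ /= Wy] Wy']].
by rewrite ltNge Wy in Wy'.
Qed.

(** Strict inequality at the bottom and on the lateral faces pushes the earliest touching point into
    the interior, where [touching] contradicts the strict supersolution property of [Z]. *)
Lemma comparison p U Z (t1 t2 r : R) b :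
  (forall t x, t1 <= t <= t2 -> box b r x -> jcont U t x) ->
  (forall t x, t1 <= t <= t2 -> box b r x -> jcont Z t x) ->
  (forall t x, t1 < t <= t2 -> box b r x -> 0 < U t x -> subsolution p U t x) ->
  (forall x, box b r x -> U t1 x < Z t1 x) ->
  (forall t x i, t1 <= t <= t2 -> box b r x -> `|x ord0 i - b ord0 i| = r ->
    U t x < Z t x) ->
  (forall t x, t1 < t <= t2 -> box b r x -> 0 < Z t x) ->
  (forall t x, t1 < t <= t2 -> box b r x -> U t x = Z t x ->
    exists2 e : R, heat_defect Z t x e & U t x `^ p < e) ->
  forall t x, t1 <= t <= t2 -> box b r x -> U t x < Z t x.
Proof.
move=> cU cZ subU init lat Z0 Zsup t x tI xB; rewrite ltNge; apply/negP => ZU.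
pose A := [set` `[t1, t2]] `*` box b r.
pose W (z : R * 'rV[R]_N) := Z z.1 z.2 - U z.1 z.2.
have AE z : A z -> t1 <= z.1 <= t2 /\ box b r z.2.
  by move=> [/= + Bz]; rewrite in_itv.
have cA : compact A by apply: compact_setX; [exact: segment_compact|exact: box_compact].
have cW z : A z -> {for z, continuous W}.
  case: z => s y /AE[/= sI yB].
  by apply: continuousB; [exact: cZ|exact: cU].
have := compact_sublevel cA cW; set Bd := (X in compact X) => cBd.
have Bd0 : Bd !=set0.
  exists (t, x); split; first by split => //=; rewrite in_itv.
  by rewrite /= /W /= subr_le0.
(* Compactness of the contact set [Bd] provides a point of earliest time. *)
have [] := @compact_EVT_min _ R fst Bd Bd0 cBd.
  by apply: continuous_subspaceT => z; exact: cvg_fst.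
move=> [s y]; rewrite inE => -[/AE[/= sI yB] Wsy] mins.
have {}Wsy : Z s y <= U s y by move: Wsy; rewrite /W /= subr_le0.
have st1 : t1 < s.
  case/andP: sI => s1 _; rewrite lt_neqAle s1 andbT; apply/eqP => s1E.
  by move: Wsy; rewrite -s1E leNgt init.
have sI' : t1 < s <= t2 by rewrite st1; case/andP: sI.
have before s' y' : t1 <= s' < s -> box b r y' -> U s' y' < Z s' y'.
  move=> /andP[s'1 s's] y'B; rewrite ltNge; apply/negP => ZU'.
  have := mins (s', y'); rewrite inE => H.
  have : s <= s'.
    apply: H; split.
      split => //=; rewrite in_itv/= s'1 /= (le_trans (ltW s's))//.
      by case/andP: sI.
    by rewrite /= /W /= subr_le0.
  by rewrite leNgt s's.
(* A strict overshoot at time [s] would persist, by continuity, at a slightly earlier time, against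
   [before]; the maximum with [t1] keeps that time in the cylinder. *)
have now y' : box b r y' -> U s y' <= Z s y'.
  move=> y'B; rewrite leNgt; apply/negP => ZU'.
  have W0 : W (s, y') < 0 by rewrite /W /= subr_lt0.
  have As : A (s, y') by split => //=; rewrite in_itv.
  have : \forall z \near (s, y'), W z < 0 by apply: (cvgr_lt _ (cW _ As)).
  move=> /near_rVP[d d0 H].
  pose s' := Num.max t1 (s - d / 2).
  have s's : s' < s by rewrite /s' gt_max st1 /=; lra.
  have := before s' y'; rewrite s's le_max lexx => /(_ isT y'B).
  apply/negP; rewrite -leNgt -subr_le0; apply/ltW/(H s' y'); last first.
    by move=> i; rewrite subrr normr0.
  rewrite distrC gtr0_norm ?subr_gt0//.
  have : s - d / 2 <= s' by rewrite /s' le_max lexx orbT.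
  by move=> ?; lra.
have UZ : U s y = Z s y by apply/eqP; rewrite eq_le Wsy now.
have [e Ze Ue] := Zsup s y sI' yB UZ.
have inside i : `|y ord0 i - b ord0 i| < r.
  rewrite lt_neqAle yB andbT; apply/eqP => yr.
  by have := lat s y i sI yB yr; rewrite UZ ltxx.
(* The room left before the bottom and the lateral faces, so that all test points stay in the
   cylinder. *)
pose d := \big[Num.min/(s - t1)]_i (r - `|y ord0 i - b ord0 i|).
have d0 : 0 < d by apply/bigmin_gtP; split => [|i _]; rewrite subr_gt0.
have : e <= U s y `^ p.
  apply: (touching (d := d) _ Ze UZ d0).
  - by apply: subU => //; rewrite UZ; exact: Z0.
  - move=> s' /andP[s'd s's]; apply/ltW/before => //; rewrite s's andbT.
    have : d <= s - t1 by exact: bigmin_le_id.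
    by move=> ?; lra.
  - move=> i h hd; apply: now => j; rewrite mxE mxE mxE eqxx /=.
    have [ij|ij] := eqVneq j i; last by rewrite mulr0 addr0; exact: yB.
    have : d <= r - `|y ord0 j - b ord0 j| by exact: bigmin_le_cond.
    rewrite -[true%:R]/(1 : R) mulr1 addrAC => ?; apply: le_trans (ler_normD _ _) _; lra.
by rewrite leNgt Ue.
Qed.

End comparison.

(** * Calculus of the heat operator on barriers *)

Section defects.
Context {R : realType} {N : nat}.
Implicit Types (Z : R -> 'rV[R]_N -> R) (t s h r e : R) (x b : 'rV[R]_N).

Lemma heat_defect_time (phi : R -> R) (phi' t : R) x :
  is_derive t (1 : R) phi phi' -> heat_defect (fun t _ => phi t) t x phi'.
Proof.
move=> phi_t; exists phi', (fun=> 0); split => //.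
  move=> i e e0; exists 1 => // h _.
  rewrite mul0r subr0 mulr2n mulrDl mul1r subrr normr0.
  by rewrite mulr_ge0 ?sqr_ge0// ltW.
by rewrite big1 ?subr0.
Qed.

Lemma heat_defectD Z1 Z2 t x e1 e2 :
  heat_defect Z1 t x e1 -> heat_defect Z2 t x e2 ->
  heat_defect (fun t x => Z1 t x + Z2 t x) t x (e1 + e2).
Proof.
move=> [z1 [c1 [Zt1 Zx1 ->]]] [z2 [c2 [Zt2 Zx2 ->]]].
exists (z1 + z2), (fun i => c1 i + c2 i); split.
- exact: is_deriveD.
- move=> i e e0; have e20 : 0 < e / 2 by lra.
  have [d1 d10 H1] := Zx1 i _ e20; have [d2 d20 H2] := Zx2 i _ e20.
  exists (Num.min d1 d2); first by rewrite lt_min d10.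
  move=> h /andP[h0]; rewrite lt_min => /andP[hd1 hd2].
  have {}H1 := H1 h; have {}H2 := H2 h.
  rewrite h0 hd1 in H1; rewrite h0 hd2 in H2; have {}H1 := H1 isT; have {}H2 := H2 isT.
  set k := h ^+ 2 in H1 H2 *.
  match goal with |- is_true (`|?c| <= _) =>
    match type of H1 with is_true (`|?a| <= _) =>
      match type of H2 with is_true (`|?b| <= _) => have -> : c = a + b by ring end end end.
  by apply: le_trans (ler_normD _ _) _; lra.
- by rewrite big_split/=; ring.
Qed.

Lemma heat_defect_timeM (phi : R -> R) (phi' t : R) Z x e :
  is_derive t (1 : R) phi phi' -> heat_defect Z t x e ->
  heat_defect (fun t x => phi t * Z t x) t x (phi' * Z t x + phi t * e).
Proof.
move=> phi_t [z [c [Zt Zx ->]]].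
exists (phi t * z + Z t x * phi'), (fun i => phi t * c i); split.
- exact: is_deriveM.
(* Adding [1] covers the case [phi t = 0]. *)
- move=> i e' e'0; have k0 : 0 < `|phi t| + 1 by rewrite ltr_pwDr.
  have [d d0 H] := Zx i _ (divr_gt0 e'0 k0).
  exists d => // h /H {}H.
  set X := (X in `|X| <= _) in H.
  have -> : phi t * Z t (x + h *: delta_mx ord0 i) + phi t * Z t (x - h *: delta_mx ord0 i)
    - 2 * (phi t * Z t x) - phi t * c i * h ^+ 2 = phi t * X by rewrite /X; ring.
  rewrite normrM; apply: (@le_trans _ _ ((`|phi t| + 1) * (e' / (`|phi t| + 1) * h ^+ 2))).
    by apply: ler_pM => //; rewrite lerDl.
  by rewrite mulrA (mulrC _ (e' / _)) divfK ?gt_eqF.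
- by rewrite -mulr_sumr; ring.
Qed.

Lemma heat_defectZ (k t : R) Z x e : heat_defect Z t x e ->
  heat_defect (fun t x => k * Z t x) t x (k * e).
Proof.
move=> Ze; have := heat_defect_timeM (is_derive_cst k t 1) Ze.
by rewrite mul0r add0r.
Qed.

Lemma heat_defect_sum (I : Type) (s : seq I) (Z : I -> R -> 'rV[R]_N -> R) t x :
  (forall i, heat_defect (Z i) t x 0) ->
  heat_defect (fun t x => \sum_(i <- s) Z i t x) t x 0.
Proof.
move=> Z0; elim: s => [|i s IHs].
  rewrite (_ : (fun t x => _) = fun _ _ => 0); last by apply/funext => ?; apply/funext => ?; rewrite big_nil.
  exact: heat_defect_time (is_derive_cst 0 t 1).
rewrite (_ : (fun t x => _) = fun t x => Z i t x + \sum_(j <- s) Z j t x); last first.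
  by apply/funext => ?; apply/funext => ?; rewrite big_cons.
by have := heat_defectD (Z0 i) IHs; rewrite addr0.
Qed.

Definition sqdist b x : R := \sum_i (x ord0 i - b ord0 i) ^+ 2.

Lemma sqdist_ge0 b x : 0 <= sqdist b x.
Proof. by apply: sumr_ge0 => i _; exact: sqr_ge0. Qed.

Lemma sqdist_coord b x i : (x ord0 i - b ord0 i) ^+ 2 <= sqdist b x.
Proof. by rewrite /sqdist (bigD1 i)//= lerDl sumr_ge0// => j _; exact: sqr_ge0. Qed.

Lemma sqdist_shift b x i h : sqdist b (x + h *: delta_mx ord0 i) =
  sqdist b x + 2 * (x ord0 i - b ord0 i) * h + h ^+ 2.
Proof.
rewrite /sqdist (bigD1 i)//= [in RHS](bigD1 i)//=.
rewrite (eq_bigr (fun j => (x ord0 j - b ord0 j) ^+ 2)); last first.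
  by move=> j ji; rewrite !mxE eqxx (negPf ji) mulr0 addr0.
by rewrite !mxE !eqxx -[true%:R]/(1 : R); ring.
Qed.

(* With [rho = |x - b|^2], [Delta (F rho) = 4 rho F'' + 2 N F']. *)
Lemma heat_defect_radial (F : R -> R -> R) (F1 : R -> R) (Ft F2 t : R) b x :
  is_derive t (1 : R) (F ^~ (sqdist b x)) Ft ->
  (\forall r \near sqdist b x, is_derive r (1 : R) (F t) (F1 r)) ->
  is_derive (sqdist b x) (1 : R) F1 F2 ->
  heat_defect (fun t x => F t (sqdist b x)) t x
    (Ft - 4 * sqdist b x * F2 - 2 * N%:R * F1 (sqdist b x)).
Proof.
move=> HFt HF1 HF2.
pose y i := x ord0 i - b ord0 i.
exists Ft, (fun i => 4 * y i ^+ 2 * F2 + 2 * F1 (sqdist b x)); split => //; last first.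
  rewrite big_split/= -mulr_suml -mulr_sumr sumr_const card_ord -/(sqdist b x).
  by rewrite -mulr_natr; ring.
move=> i e e0.
(* Along a coordinate line the squared distance is this quadratic, which reduces the claim to the
   one-variable symmetric second difference of [F t \o q]. *)
pose q (h : R) := sqdist b x + 2 * y i * h + h ^+ 2.
have q_diff h : is_derive h (1 : R) q (2 * y i + 2 * h).
  rewrite /q; apply: is_derive_eq; rewrite /GRing.scale/=; ring.
have q0 : q 0 = sqdist b x by rewrite /q; ring.
have H1 : \forall h \near (0 : R), is_derive h (1 : R) (F t \o q) (F1 (q h) * (2 * y i + 2 * h)).
  have cq : q h @[h --> (0 : R)] --> sqdist b x.
    rewrite -q0; apply/differentiable_continuous/derivable1_diffP.
    by have [] := q_diff 0.
  near=> h.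
  have Hh : is_derive (q h) (1 : R) (F t) (F1 (q h)) by near: h; exact: (cq _ HF1).
  exact: is_derive1_comp.
have H2 : is_derive (0 : R) (1 : R) (fun h => F1 (q h) * (2 * y i + 2 * h))
    (4 * y i ^+ 2 * F2 + 2 * F1 (sqdist b x)).
  have F2q : is_derive (q 0) (1 : R) F1 F2 by rewrite q0.
  have A : is_derive (0 : R) (1 : R) (F1 \o q) (F2 * (2 * y i + 2 * 0)) by exact: is_derive1_comp.
  apply: is_derive_eq; rewrite /= q0 /GRing.scale/=; ring.
have [d d0 H] := sym_second_difference H1 H2 e0.
exists d => // h /H; rewrite /= q0 /q.
rewrite -[- (h *: _)]scaleNr !sqdist_shift -/(y i) sqrrN mulrN.
by [].
Unshelve. all: by end_near. Qed.

End defects.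

(** * Uniform continuity and elementary inequalities for real powers *)

Section uniform_continuity.
Context {R : realType}.

(** The point [y] may leave [K]: [f] is continuous at points of [K] as a function on all of [X]. A
    common radius comes from the near-covering form of compactness. *)
Lemma uniform_continuity_compact (X : pseudoMetricType R) (K : set X) (f : X -> R) :
  compact K -> (forall x, K x -> {for x, continuous f}) ->
  forall e : R, 0 < e -> exists2 d : R, 0 < d &
    forall x y, K x -> ball x d y -> `|f x - f y| < e.
Proof.
move=> cK cf e e0.
have := (compact_near_coveringP K).1 cK R (0^'+)
  (fun d x => forall y, ball x d y -> `|f x - f y| < e) _.
move=> H.
have {}H : \forall d \near 0^'+, K `<=` (fun x => forall y, ball x d y -> `|f x - f y| < e).
  apply: H => x Kx; have /cvgrPdist_lt/(_ _ (divr_gt0 e0 (ltr0n _ 2)))/= := cf x Kx.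
  move=> /nbhs_ballP[d' d'0 fd']; pose d : R := d'; have d0 : 0 < d := d'0.
  have {}fd' : forall y, ball x d y -> `|f x - f y| < e / 2 := fd'.
  exists (ball x (d / 2), [set d : R | 0 < d < d' / 2]) => /=.
    split; first by apply: nbhsx_ballx; rewrite divr_gt0.
    near=> d'' => /=; apply/andP; split; first by near: d''; exact: nbhs_right_gt.
    by near: d''; apply: nbhs_right_lt; rewrite divr_gt0.
  move=> [x' d''] [/= xx' /andP[_ d''d]] y x'y.
  have A : `|f x - f x'| < e / 2.
    by apply: fd'; apply: le_ball xx'; lra.
  have B : `|f x - f y| < e / 2.
    apply: fd'; rewrite [d]splitr; apply: ball_triangle xx' _.
    by apply: le_ball x'y; exact: ltW.
  have -> : f x' - f y = (f x - f y) - (f x - f x') by ring.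
  by apply: le_lt_trans (ler_normB _ _) _; lra.
have [d [d0 Hd]] : exists d : R, 0 < d /\ K `<=` (fun x => forall y, ball x d y -> `|f x - f y| < e).
  near (0 : R)^'+ => d; exists d; split; first by near: d; exact: nbhs_right_gt.
  by near: d.
by exists d => // x y Kx; exact: Hd.
Unshelve. all: by end_near. Qed.

(** Differentiability gives continuity away from the origin but may fail there, so at [0] the
    inequality [|x|^q < e] is solved for [|x|]. *)
Lemma continuous_norm_powR (q : R) : 0 < q -> continuous (fun y : R => `|y| `^ q).
Proof.
move=> q0 y; have [->|y0] := eqVneq y 0; last first.
  apply: (@continuous_comp R R R (@Num.norm _ R) (fun z : R => z `^ q)).
    exact: norm_continuous.
  apply/differentiable_continuous/derivable1_diffP.
  by apply: derivable_powR; rewrite in_itv/= andbT normr_gt0.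
apply/cvgrPdist_lt => e e0; near=> x.
rewrite normr0 powR0 ?gt_eqF// sub0r normrN ger0_norm ?powR_ge0//.
have xe : `|x| < e `^ q^-1.
  near: x; have := cvgr_lt (`|0 : R|) (@norm_continuous _ _ (0 : R)).
  by apply; rewrite normr0 powR_gt0.
have := gt0_ltr_powR q0 _ _ xe; rewrite !nnegrE normr_ge0 powR_ge0 => /(_ isT isT).
by rewrite -powRrM mulVf ?gt_eqF// powRr1// ltW.
Unshelve. all: by end_near. Qed.

(** The substitute for Hoelder's inequality when [q] may be below [1]: if [y > d] then [y^q >= d^q],
    while [y] itself is at most [M]. *)
Lemma powR_dominates_near0 (q M d : R) : 0 < q -> 0 < d ->
  exists2 C : R, 0 < C & forall y, 0 <= y <= M -> y <= d + C * y `^ q.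
Proof.
move=> q0 d0; have dq : 0 < d `^ q by exact: powR_gt0.
exists ((`|M| + 1) / d `^ q); first by rewrite divr_gt0// ltr_pwDr.
move=> y /andP[y0 yM]; have [yd|dy] := leP y d.
  by rewrite (le_trans yd)// lerDl mulr_ge0 ?powR_ge0// divr_ge0 ?powR_ge0// addr_ge0.
have dyq : d `^ q <= y `^ q.
  by apply: ge0_ler_powR; rewrite ?nnegrE//; exact: ltW.
apply: (@le_trans _ _ (`|M| + 1)).
  by rewrite (le_trans yM)// (le_trans (ler_norm _))// lerDl.
rewrite -[leLHS](divfK (lt0r_neq0 dq)) ler_wpDl ?(ltW d0)// ler_wpM2l//.
by rewrite divr_ge0 ?ltW// addr_ge0.
Qed.

(** Only [y] has to be bounded. If [|y - z|] is below the modulus of continuity [r], the error is at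
    most [d]; otherwise [|y - z| / r >= 1] absorbs the whole left side. *)
Lemma powR_diff_bound (q B d : R) : 0 < q -> 0 < d ->
  exists2 C : R, 0 < C & forall y z : R, `|y| <= B ->
    `|y| `^ q <= `|z| `^ q + d + C * `|y - z|.
Proof.
move=> q0 d0.
have [r r0 Hr] := uniform_continuity_compact (@segment_compact R (- B) B)
  (fun x _ => @continuous_norm_powR _ q0 x) d0.
exists ((`|B| `^ q + 1) / r); first by rewrite divr_gt0// ltr_pwDr ?powR_ge0.
move=> y z yB; have [yz|yz] := ltP `|y - z| r.
  have := Hr y z; rewrite /= in_itv/= -ler_norml yB => /(_ isT yz).
  rewrite ltr_norml => /andP[_ H].
  have : 0 <= (`|B| `^ q + 1) / r * `|y - z|.
    by rewrite mulr_ge0// divr_ge0 ?ltW// ltr_pwDr ?powR_ge0.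
  by move=> ?; lra.
have : `|y| `^ q <= `|B| `^ q.
  apply: ge0_ler_powR; rewrite ?nnegrE//; first exact: ltW.
  by rewrite (le_trans yB)// ler_norm.
have : `|B| `^ q + 1 <= (`|B| `^ q + 1) / r * `|y - z|.
  have a0 : 0 <= `|B| `^ q + 1 by rewrite addr_ge0 ?powR_ge0.
  by rewrite mulrAC -mulrA; apply: ler_peMr => //; rewrite ler_pdivlMr ?mul1r.
have := powR_ge0 `|z| q.
by move=> *; lra.
Qed.

End uniform_continuity.

(** * The barrier up to the blow-up time *)

Section blowup_barrier.
Context {R : realType} {N : nat}.
Implicit Types (U : R -> 'rV[R]_N -> R) (x b : 'rV[R]_N).

Lemma sqdist_continuous b : continuous (sqdist b).
Proof.
rewrite /sqdist; apply: (@continuous_big _ _ +%R 0) => //.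
  exact: add_continuous.
move=> i _ x.
apply: (@continuous_comp _ _ _ (fun x => x ord0 i - b ord0 i) (fun y : R => y ^+ 2)).
  by apply: continuousB; [exact: coord_continuous|exact: cst_continuous].
exact: exprn_continuous.
Qed.

Lemma jcont_sqdist b (t : R) x : jcont (fun _ => sqdist b) t x.
Proof.
apply: (@continuous_comp _ _ _ snd (sqdist b)); first exact: cvg_snd.
exact: sqdist_continuous.
Qed.

Lemma jcont_time (phi : R -> R) (t : R) x : {for t, continuous phi} ->
  jcont (fun t (_ : 'rV[R]_N) => phi t) t x.
Proof.
by move=> c; apply: (@continuous_comp _ _ _ fst phi); first exact: cvg_fst.
Qed.

Lemma is_derive_expn (f : R -> R) (x df : R) n : is_derive x (1 : R) f df ->
  is_derive x (1 : R) (fun y => f y ^+ n.+1) (n.+1%:R * f x ^+ n * df).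
Proof.
move=> fx; have H := is_deriveX n.+1 fx.
rewrite (_ : (fun y => _) = f ^+ n.+1); last by apply/funext => y; rewrite exprfctE.
exact: (is_derive_eq H).
Qed.

Lemma is_derive_scalel (c : R) (f : R -> R) (x df : R) : is_derive x (1 : R) f df ->
  is_derive x (1 : R) (fun y => c * f y) (c * df).
Proof. by move=> fx; exact: (is_deriveZ c fx). Qed.

(* [e1 (1 + t)] absorbs [u^p] where [u] is small; the second term dominates the
   type I rate on the lateral boundary and vanishes to high order at [b]. *)
Definition typeI_barrier (e1 ee : R) n b (t : R) x : R :=
  e1 * (1 + t) + ee * (((1 - t)^-1) ^+ n * sqdist b x ^+ n.+1).

Lemma typeI_barrier_jcont e1 ee n b (t : R) x : t < 1 ->
  jcont (typeI_barrier e1 ee n b) t x.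
Proof.
move=> t1; rewrite /typeI_barrier /jcont /=.
have c1 : {for (t, x), continuous (fun z : R * 'rV[R]_N => e1 * (1 + z.1))}.
  apply: (@jcont_time (fun t => e1 * (1 + t))).
  apply: continuousM; first exact: cst_continuous.
  by apply: continuousD; [exact: cst_continuous|by move=> A].
have c2 : {for (t, x), continuous (fun z : R * 'rV[R]_N => ((1 - z.1)^-1) ^+ n)}.
  apply: (@jcont_time (fun t => ((1 - t)^-1) ^+ n)).
  apply: (@continuous_comp R R R (fun t => (1 - t)^-1) (fun y : R => y ^+ n)).
    apply: continuousV; first by rewrite gt_eqF// subr_gt0.
    by apply: continuousB; [exact: cst_continuous|by move=> A].
  exact: exprn_continuous.
have c3 : {for (t, x), continuous (fun z : R * 'rV[R]_N => sqdist b z.2 ^+ n.+1)}.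
  apply: (@continuous_comp _ _ _ (fun z : R * 'rV[R]_N => sqdist b z.2) (fun y : R => y ^+ n.+1)).
    exact: jcont_sqdist.
  exact: exprn_continuous.
apply: (continuousD c1); apply: continuousM; first exact: cst_continuous.
exact: (continuousM c2 c3).
Qed.

(** Because the power of the squared distance is one above that of [(1 - t)^-1], the time derivative
    and the Laplacian depend on the similarity variable [s] alone, and the negative part of the
    defect is bounded uniformly in [t] and [x]. *)
Lemma typeI_barrier_defect e1 ee n b (t : R) x : t < 1 ->
  let s := (1 - t)^-1 * sqdist b x in
  heat_defect (typeI_barrier e1 ee n.+1 b) t x
   (e1 + ee * (s ^+ n.+1 * (n.+1%:R * s - (n.+2)%:R * (4 * n.+1%:R + 2 * N%:R)))).
Proof.
move=> t1 s; have t10 : 1 - t != 0 by rewrite gt_eqF// subr_gt0.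
apply: heat_defectD.
  apply: heat_defect_time.
  by apply: is_derive_eq; rewrite /GRing.scale/=; ring.
apply: heat_defectZ.
set v := (1 - t)^-1 in s *.
have dv : is_derive t (1 : R) (fun t : R => (1 - t)^-1) (v ^+ 2).
  apply: is_derive_eq; rewrite /GRing.scale/= -/v -exprVn -/v; ring.
pose F (t r : R) := ((1 - t)^-1) ^+ n.+1 * r ^+ n.+2.
pose F1 (r : R) := v ^+ n.+1 * (n.+2%:R * r ^+ n.+1).
set rho := sqdist b x in s *.
have H1 : is_derive t (1 : R) (F ^~ rho) (n.+1%:R * v ^+ n.+2 * rho ^+ n.+2).
  rewrite (_ : F ^~ rho = (fun t => rho ^+ n.+2 * ((1 - t)^-1) ^+ n.+1)).
    apply: (is_derive_eq (is_derive_scalel _ (is_derive_expn n dv))).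
    by rewrite -/v !exprS; ring.
  by apply/funext => y; rewrite /F mulrC.
have H2 (r : R) : is_derive r (1 : R) (F t) (F1 r).
  apply: (is_derive_eq (is_derive_scalel _ (is_derive_expn n.+1 (is_derive_id r 1)))).
  by rewrite mulr1.
have H3 : is_derive rho (1 : R) F1 (v ^+ n.+1 * (n.+2%:R * (n.+1%:R * rho ^+ n))).
  apply: is_derive_scalel; apply: is_derive_scalel.
  by apply: (is_derive_eq (is_derive_expn n (is_derive_id rho 1))); rewrite mulr1.
have H2' : \forall r \near sqdist b x, is_derive r (1 : R) (F t) (F1 r).
  by near=> r; exact: H2.
have := heat_defect_radial H1 H2' H3.
congr (heat_defect _ _ _ _); rewrite /s /F1 -/rho !exprMn !exprS; ring.
Unshelve. all: by end_near.
Qed.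

(** The type I rate turns the nonlinearity into a linear term with the critical potential
    [M^(p-1) / (1 - t)]. *)
Lemma typeI_powR (M p : R) (t y : R) : 1 < p -> 0 < M -> t < 1 -> 0 <= y ->
  y <= M * (1 - t) `^ (- (p - 1)^-1) -> y `^ p <= M `^ (p - 1) * (1 - t)^-1 * y.
Proof.
move=> p1 M0 t1 y0 yM; have p10 : 0 < p - 1 by rewrite subr_gt0.
rewrite -mulr_powRB1//; last by rewrite (lt_trans ltr01).
rewrite mulrC ler_wpM2r//.
have -> : M `^ (p - 1) * (1 - t)^-1 = (M * (1 - t) `^ (- (p - 1)^-1)) `^ (p - 1).
  rewrite powRM ?powR_ge0 ?(ltW M0)// -powRrM mulNr mulVf ?gt_eqF//.
  by rewrite powR_inv1// subr_ge0 ltW.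
by apply: ge0_ler_powR; rewrite ?nnegrE ?(ltW p10)// mulr_ge0 ?powR_ge0// ltW.
Qed.

(** A large [n] lets the time derivative of the second barrier term exceed twice the critical
    potential times that term, and lets [(1 - t)^-(n+1)] dominate the type I rate; a large [r] then
    lifts the barrier above [U] on the lateral faces; a small [ee] keeps the negative part of the
    defect below [e1 / 2]. The second term vanishes at the centre, which is why only [U t b] is
    bounded. *)
Lemma small_data_bounded (p M e1 ee r : R) (n : nat) U b :
  let D := n.+2%:R * (4 * n.+1%:R + 2 * N%:R) in
  1 < p -> 0 < M -> 0 < e1 -> 0 < ee -> 0 < r ->
  2 * M `^ (p - 1) + 1 <= n.+1%:R -> (p - 1)^-1 <= n.+1%:R ->
  ee * D ^+ n.+2 < e1 / 2 -> (4 * e1) `^ p <= e1 / 2 ->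
  M <= ee * r ^+ 2 ^+ n.+2 ->
  (forall t x, 2^-1 <= t < 1 -> jcont U t x) ->
  (forall t x, 2^-1 <= t < 1 -> 0 < U t x -> subsolution p U t x) ->
  (forall t x, 2^-1 <= t < 1 -> 0 <= U t x <= M * (1 - t) `^ (- (p - 1)^-1)) ->
  (forall x, box b r x -> U 2^-1 x <= e1) ->
  forall t, 2^-1 <= t < 1 -> U t b <= 2 * e1.
Proof.
move=> D p1 M0 e10 ee0 r0 nM np eeD e1p rM cU subU typeI init t /andP[tge t1].
pose Z := typeI_barrier e1 ee n.+1 b.
have D0 : 0 <= D by rewrite mulr_ge0// addr_ge0// mulr_ge0.
have {}tI (s : R) : 2^-1 <= s <= t -> 2^-1 <= s < 1.
  by move=> /andP[-> st]; rewrite (le_lt_trans st).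
have ZE s x : Z s x = e1 * (1 + s) + ee * (((1 - s)^-1) ^+ n.+1 * sqdist b x ^+ n.+2) by [].
have W0 s x : s < 1 -> 0 <= ee * (((1 - s)^-1) ^+ n.+1 * sqdist b x ^+ n.+2).
  move=> s1; rewrite mulr_ge0 ?(ltW ee0)// mulr_ge0// exprn_ge0 ?sqdist_ge0//.
  by rewrite invr_ge0 subr_ge0 ltW.
have Zlow s x : 2^-1 <= s < 1 -> e1 < Z s x.
  move=> /andP[s2 s1]; rewrite ZE; have := W0 s x s1.
  have : 0 < e1 * s by rewrite mulr_gt0//; lra.
  by move=> *; lra.
have bb : box b r b by move=> i; rewrite subrr normr0 ltW.
suff H : U t b < Z t b.
  apply: (le_trans (ltW H)); rewrite ZE /sqdist.
  rewrite big1 ?expr0n/= ?mulr0 ?addr0; last by move=> i _; rewrite subrr expr0n.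
  by rewrite mulrC ler_pM2r//; lra.
apply: (@comparison _ _ p U Z 2^-1 t r b) => //; last by rewrite tge lexx.
- by move=> s x /tI /andP[s2 s1] _; apply: cU; rewrite s2.
- by move=> s x /tI /andP[s2 s1] _; exact: typeI_barrier_jcont.
- move=> s x /andP[s2 st] _; apply: subU.
  by apply: tI; rewrite (ltW s2).
- move=> x xB; apply: le_lt_trans (init x xB) _; apply: Zlow.
  by rewrite lexx /=; lra.
- move=> s x i sI xB xr; have /andP[s2 s1] := tI s sI.
  have /andP[_ Ule] := typeI s x (tI s sI).
  apply: le_lt_trans Ule _; rewrite ZE.
  have tau0 : 0 < 1 - s <= 1 by apply/andP; split; lra.
  have e1s : 0 < e1 * (1 + s) by rewrite mulr_gt0//; lra.
  apply: ltr_pwDl => //.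
  have A : (1 - s) `^ (- (p - 1)^-1) <= (1 - s)^-1 ^+ n.+1.
    rewrite exprVn -powR_invn; last by lra.
    by apply: ger_powR => //; rewrite lerN2.
  apply: le_trans (ler_wpM2l (ltW M0) A) _.
  rewrite [leRHS]mulrCA mulrC ler_wpM2l//.
    by rewrite exprn_ge0// invr_ge0; lra.
  apply: (le_trans rM); rewrite ler_wpM2l ?(ltW ee0)// lerXn2r ?nnegrE ?sqr_ge0 ?sqdist_ge0//.
  by rewrite -xr -normrX ger0_norm ?sqr_ge0// sqdist_coord.
- by move=> s x /andP[s2 st] _; apply: lt_trans e10 (Zlow _ _ (tI _ _)); rewrite (ltW s2).
move=> s x /andP[s2' st] xB UZ.
have sI : 2^-1 <= s < 1 by apply: tI; rewrite (ltW s2').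
have /andP[s2 s1] := sI.
have := @typeI_barrier_defect e1 ee n b s x s1.
set w := (1 - s)^-1 * sqdist b x => /= Zw.
exists (e1 + ee * (w ^+ n.+1 * (n.+1%:R * w - D))) => //.
have w0 : 0 <= w by rewrite mulr_ge0 ?sqdist_ge0// invr_ge0; lra.
pose W := ee * (((1 - s)^-1) ^+ n.+1 * sqdist b x ^+ n.+2).
have ww : (1 - s)^-1 * W = ee * w ^+ n.+2.
  by rewrite /W /w; move: (1 - s)^-1 => v; rewrite exprMn [v ^+ n.+2]exprS; ring.
have ew : 0 <= ee * w ^+ n.+2 by rewrite mulr_ge0 ?exprn_ge0// ltW.
have n1 : 0 <= n.+1%:R - 1 :> R by have := powR_ge0 M (p - 1); lra.
have Up : U s x `^ p <= e1 / 2 + (n.+1%:R - 1) * (ee * w ^+ n.+2).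
  have /andP[U0 Ule] := typeI s x sI.
  (* Where [W <= 2 e1], contact gives [U <= 4 e1] and superlinearity yields [U^p <= e1 / 2].
     Otherwise [U <= 2 W] and the linear type I bound applies; this is the source of the factor [2]
     in [2 M^(p-1) + 1 <= n + 1]. *)
  have [Wsmall|Wbig] := leP W (2 * e1).
    apply: (@le_trans _ _ (e1 / 2)); last first.
      by rewrite lerDl mulr_ge0.
    apply: le_trans e1p; apply: ge0_ler_powR; rewrite ?nnegrE//; [lra|lra|].
    rewrite UZ ZE -/W; have : e1 * s <= e1 by rewrite ger_pMr// ltW.
    by move=> ?; lra.
  apply: le_trans (typeI_powR p1 M0 s1 U0 Ule) _.
  have UW : U s x <= 2 * W.
    rewrite UZ ZE -/W; have : e1 * s <= e1 by rewrite ger_pMr// ltW.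
    by move=> ?; lra.
  apply: (@le_trans _ _ (M `^ (p - 1) * (1 - s)^-1 * (2 * W))).
    by rewrite ler_wpM2l// mulr_ge0 ?powR_ge0// invr_ge0; lra.
  have -> : M `^ (p - 1) * (1 - s)^-1 * (2 * W) = 2 * M `^ (p - 1) * (ee * w ^+ n.+2).
    by rewrite -ww; ring.
  have := ler_wpM2r ew (_ : 2 * M `^ (p - 1) <= n.+1%:R - 1).
  by move=> H; apply: le_trans (H _) _; lra.
apply: le_lt_trans Up _.
(* The spare [1] in the lower bound on [n] leaves one extra [w^(n+2)]: it outweighs [D w^(n+1)] once
   [w >= D], and below [D] the product is at most [D^(n+2)]. *)
have key : ee * (w ^+ n.+1 * (D - w)) < e1 / 2.
  have [Dw|wD] := leP D w.
    apply: (@le_lt_trans _ _ 0); last by lra.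
    by rewrite mulr_ge0_le0 ?(ltW ee0)// mulr_ge0_le0 ?exprn_ge0// subr_le0.
  apply: le_lt_trans eeD; rewrite ler_wpM2l ?(ltW ee0)// [D ^+ _]exprSr.
  apply: ler_pM; [exact: exprn_ge0|by rewrite subr_ge0 ltW| |by rewrite gerBl].
  by apply: lerXn2r; rewrite ?nnegrE ?(ltW wD).
rewrite -subr_gt0.
have -> : e1 + ee * (w ^+ n.+1 * (n.+1%:R * w - D)) - (e1 / 2 + (n.+1%:R - 1) * (ee * w ^+ n.+2))
  = e1 / 2 - ee * (w ^+ n.+1 * (D - w)) by rewrite [w ^+ n.+2]exprSr; field.
by rewrite subr_gt0.
Qed.

End blowup_barrier.

(** * Gaussians and grids of cubes *)

Section smoothing.
Context {R : realType} {N : nat}.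
Implicit Types (U : R -> 'rV[R]_N -> R) (x c : 'rV[R]_N).

(* Up to a constant, the heat kernel at time [t + s] centred at [c]. *)
Definition gauss (s : R) c (t : R) x : R :=
  expR (- (N%:R / 2) * ln (t + s) - sqdist c x / (4 * (t + s))).

Lemma gauss_jcont s c t x : 0 < t + s -> jcont (gauss s c) t x.
Proof.
move=> ts; apply: (@continuous_comp _ _ _ (fun z : R * 'rV[R]_N =>
  - (N%:R / 2) * ln (z.1 + s) - sqdist c z.2 / (4 * (z.1 + s))) (@expR R)); last first.
  exact: continuous_expR.
have cs : {for (t, x), continuous (fun z : R * 'rV[R]_N => z.1 + s)}.
  by apply: continuousD; [exact: cvg_fst|exact: cst_continuous].
apply: continuousB; apply: continuousM.
- exact: cst_continuous.
- apply: (@continuous_comp _ _ _ (fun z : R * 'rV[R]_N => z.1 + s) (@ln R)) => //.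
  exact: continuous_ln.
- exact: jcont_sqdist.
- apply: (@continuousV _ _ (fun z : R * 'rV[R]_N => 4 * (z.1 + s))).
    by rewrite mulf_neq0// gt_eqF.
  by apply: continuousM => //; exact: cst_continuous.
Qed.

Lemma gauss_defect s c t x : 0 < t + s -> heat_defect (gauss s c) t x 0.
Proof.
move=> ts; have tsn : t + s != 0 by rewrite gt_eqF.
pose F (t r : R) := expR (- (N%:R / 2) * ln (t + s) - r / (4 * (t + s))).
set rho := sqdist c x; set k := (4 * (t + s))^-1.
have d1 : is_derive t (1 : R) (fun t : R => t + s) 1.
  by apply: is_derive_eq; rewrite addr0.
have d2 : is_derive t (1 : R) (fun t : R => ln (t + s)) (t + s)^-1.
  apply: (is_derive_eq (@is_derive1_comp _ (@ln R) (fun t : R => t + s) t _ _ _ d1)).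
    exact: is_derive1_ln.
  by rewrite mulr1.
have d3 : is_derive t (1 : R) (fun t : R => (4 * (t + s))^-1) (- 4 * k ^+ 2).
  apply: (is_derive_eq (is_deriveV _ (is_derive_scalel 4 d1))).
    by rewrite mulf_neq0.
  by rewrite mulr1 /k /GRing.scale/= exprVn; move: (_ ^- 2) => a; ring.
have H1 : is_derive t (1 : R) (F ^~ rho)
    (F t rho * (- (N%:R / 2) * (t + s)^-1 + rho * (4 * k ^+ 2))).
  apply: (@is_derive1_comp _ (@expR R) (fun t => - (N%:R / 2) * ln (t + s) - rho / (4 * (t + s)))).
  apply: (is_derive_eq (is_deriveB (is_derive_scalel _ d2) (is_derive_scalel rho d3))).
  by ring.
have dr (r : R) : is_derive r (1 : R) (F t) (- k * F t r).
  have d4 : is_derive r (1 : R) (fun r => - (N%:R / 2) * ln (t + s) - r * k) (- k).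
    apply: (is_derive_eq (is_deriveB (is_derive_cst _ _ _)
      (is_deriveM (is_derive_id _ _) (is_derive_cst k _ _)))).
    by rewrite /GRing.scale/=; ring.
  apply: (is_derive_eq (@is_derive1_comp _ (@expR R) _ r _ _ _ d4)).
  by rewrite /F -/k mulrC.
have dr' : \forall r \near sqdist c x, is_derive r (1 : R) (F t) (- k * F t r).
  by near=> r; exact: dr.
have H3 : is_derive (sqdist c x) (1 : R) (fun r => - k * F t r) (- k * (- k * F t rho)).
  by apply: is_derive_scalel; exact: dr.
have := heat_defect_radial H1 dr' H3.
congr (heat_defect _ _ _ _); rewrite -/rho /k; field.
exact: tsn.
Unshelve. all: by end_near.
Qed.

Lemma gauss_lower (s : R) c x : 0 < s -> sqdist c x <= N%:R * s ->
  expR (- (N%:R / 2) * ln s) * expR (- (N%:R / 4)) <= gauss s c 0 x.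
Proof.
move=> s0 xs; rewrite -expRD ler_expR add0r lerD2l lerN2.
rewrite ler_pdivrMr ?mulr_gt0//.
by have -> : N%:R / 4 * (4 * s) = N%:R * s by field.
Qed.

(** By time 1/2 the initial width no longer matters, since [(1/2 + s)^(-N/2) <= 2^(N/2)]; the mesh
    can therefore be refined at no cost. *)
Lemma gauss_upper (s : R) c x : 0 < s -> gauss s c 2^-1 x <= expR (N%:R / 2 * ln 2).
Proof.
move=> s0; rewrite ler_expR.
have H : 0 < 2^-1 + s by rewrite addr_gt0.
have : 0 <= sqdist c x / (4 * (2^-1 + s)) by rewrite mulr_ge0 ?sqdist_ge0// invr_ge0 mulr_ge0// ltW.
have : - ln 2 <= ln (2^-1 + s).
  by rewrite -lnV ?posrE// ler_ln ?posrE// lerDl ltW.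
move=> /(ler_wpM2l (_ : 0 <= N%:R / 2)) => /(_ (divr_ge0 (ler0n _ _) (ler0n _ _))).
by move=> *; lra.
Qed.

Definition cube_corner (b m : nat) (j : {ffun 'I_N -> 'I_(2 * b * m)}) : 'rV[R]_N :=
  \row_i (- b%:R + (j i)%:R / m%:R).

(** The cubes are half-open so as to tile [[-b, b[^N] without overlap; lower sums then compare
    directly with an integral. *)
Definition cube (b m : nat) (j : {ffun 'I_N -> 'I_(2 * b * m)}) : set 'rV[R]_N :=
  [set x | forall i, cube_corner j ord0 i <= x ord0 i < cube_corner j ord0 i + m%:R^-1].

Lemma cube_cover (b m : nat) x : (0 < m)%N ->
  (forall i, - b%:R <= x ord0 i < b%:R) -> exists j : {ffun 'I_N -> 'I_(2 * b * m)}, cube j x.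
Proof.
move=> m0 xb; have m0' : 0 < m%:R :> R by rewrite ltr0n.
have y0 i : 0 <= (x ord0 i + b%:R) * m%:R.
  by rewrite mulr_ge0//; have /andP[? ?] := xb i; lra.
have kP i : (Num.truncn ((x ord0 i + b%:R) * m%:R) < 2 * b * m)%N.
  rewrite -(ltr_nat R); have := truncn_itv (y0 i) => /andP[H _].
  apply: le_lt_trans H _; rewrite !natrM ltr_pM2r//.
  by have /andP[? ?] := xb i; lra.
exists [ffun i => Ordinal (kP i)] => i; rewrite mxE ffunE /=.
have := truncn_itv (y0 i); rewrite -natr1 => /andP[].
move: (Num.truncn _)%:R => k.
rewrite -ler_pdivrMr// -ltr_pdivlMr// mulrDl mul1r => *; apply/andP; split; lra.
Qed.

Lemma cube_corner_in (b m : nat) (j : {ffun 'I_N -> 'I_(2 * b * m)}) :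
  (0 < m)%N -> cube j (cube_corner j).
Proof. by move=> m0 i; rewrite lexx ltrDl invr_gt0 ltr0n. Qed.

Lemma cube_sub_box (b m : nat) (j : {ffun 'I_N -> 'I_(2 * b * m)}) :
  (0 < m)%N -> cube j `<=` box 0 b%:R.
Proof.
move=> m0 x jx i; have := jx i; rewrite !mxE subr0 ler_norml => /andP[].
have m0' : 0 < m%:R :> R by rewrite ltr0n.
have : (j i)%:R / m%:R + m%:R^-1 <= 2 * b%:R :> R.
  rewrite -[X in _ + X]mul1r -mulrDl ler_pdivrMr// natr1 -!natrM ler_nat.
  exact: ltn_ord.
have : 0 <= (j i)%:R / m%:R :> R by rewrite divr_ge0.
by move=> *; apply/andP; split; lra.
Qed.

End smoothing.

(** * Smallness at time 1/2 from small lower sums at time 0 *)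

Section smoothing_estimate.
Context {R : realType} {N : nat}.
Implicit Types (U : R -> 'rV[R]_N -> R) (x : 'rV[R]_N).

Lemma jcont_slice U (t : R) x : jcont U t x -> {for x, continuous (U t)}.
Proof.
move=> /jcontP cU; have FF : Filter (nbhs x) by exact: nbhs_filter.
apply/cvgrPdist_lt => e /cU[d d0 H].
suff : \forall y \near x, `|U t x - U t y| < e by [].
apply/nbhs_ballP; exists d => // y [_ xy]; rewrite /= distrC.
by apply: H => [|i]; [rewrite subrr normr0|rewrite distrC; exact: xy].
Qed.

Lemma jcont_sum (I : Type) (s : seq I) (F : I -> R -> 'rV[R]_N -> R) t x :
  (forall i, jcont (F i) t x) -> jcont (fun t x => \sum_(i <- s) F i t x) t x.
Proof.
move=> cF; elim: s => [|i s IH].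
  rewrite (_ : (fun t x => _) = fun _ _ => 0); first exact: cst_continuous.
  by apply/funext => ?; apply/funext => ?; rewrite big_nil.
rewrite (_ : (fun t x => _) = fun t x => F i t x + \sum_(j <- s) F j t x).
  by apply: continuousD; [exact: cF|exact: IH].
by apply/funext => ?; apply/funext => ?; rewrite big_cons.
Qed.

(* On a fine grid of cubes of side [1 / m], [U 0] lies below [d] plus a sum of
   Gaussians of width [1 / m] centred at the corners, whose total mass is
   controlled by a lower Riemann sum of [U 0 ^ q]. *)
Lemma smoothing_estimate (p q M2 d C e1 eta R1 r : R) (b : nat) U :
  let K := M2 `^ (p - 1) + 1 in
  1 < p -> 0 < q -> 0 < M2 -> 0 < d -> 0 < C ->
  (forall y, 0 <= y <= M2 -> y <= d / 2 + C * y `^ q) ->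
  0 < R1 -> R1 < b%:R -> r <= R1 ->
  expR (K / 2) * (d + M2 / R1 ^+ 2 * (N%:R * r ^+ 2 + N%:R) +
     C * expR (N%:R / 4) * expR (N%:R / 2 * ln 2) * eta) <= e1 ->
  (forall t x, 0 <= t <= 2^-1 -> jcont U t x) ->
  (forall t x, 0 < t <= 2^-1 -> 0 < U t x -> subsolution p U t x) ->
  (forall t x, 0 <= t <= 2^-1 -> 0 <= U t x <= M2) ->
  (forall (m : nat) (w : {ffun 'I_N -> 'I_(2 * b * m)} -> R), (0 < m)%N ->
     (forall j, 0 <= w j) -> (forall j x, cube j x -> w j <= U 0 x `^ q) ->
     \sum_j w j * m%:R^-1 ^+ N <= eta) ->
  forall x, box 0 r x -> U 2^-1 x <= e1.
Proof.
move=> K p1 q0 M20 d0 C0 dC R10 R1b rR1 e1P cU subU Ub LS x xr.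
have h00 : 0 <= (0 : R) <= 2^-1 by lra.
have C8 : 0 < d / (8 * C) by rewrite divr_gt0// mulr_gt0.
have cf y : box 0 b%:R y -> {for y, continuous (fun y => `|U 0 y| `^ q)}.
  move=> _; apply: (@continuous_comp _ _ _ (U 0) (fun y : R => `|y| `^ q)).
    by apply: jcont_slice; exact: cU.
  exact: continuous_norm_powR.
have [rho rho0 Hrho] := uniform_continuity_compact (@box_compact R N 0 b%:R) cf C8.
(* Cubes of side [1 / m < rho], on each of which [U 0 ^ q] varies by less than [d / (8 C)]. *)
pose m := (Num.truncn rho^-1).+1.
have m0 : 0 < m%:R :> R by rewrite ltr0n.
have mrho : m%:R^-1 < rho.
  by rewrite -[ltRHS]invrK ltf_pV2 ?posrE ?invr_gt0// real_truncnS_gt// num_real.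
pose J := {ffun 'I_N -> 'I_(2 * b * m)}.
(* Subtracting the oscillation makes [w j] a lower bound for [U 0 ^ q] on the whole cube, hence an
   admissible lower sum. *)
pose w (j : J) := Num.max 0 (U 0 (cube_corner j) `^ q - d / (8 * C)).
have w0 j : 0 <= w j by rewrite le_max lexx.
have osc (j : J) y : cube j y ->
    `|U 0 y `^ q - U 0 (cube_corner j) `^ q| < d / (8 * C).
  move=> jy; have := Hrho (cube_corner j) y.
  have /andP[Uc _] := Ub 0 (cube_corner j) h00; have /andP[Uy _] := Ub 0 y h00.
  rewrite (ger0_norm Uc) (ger0_norm Uy) distrC; apply.
    by apply: (@cube_sub_box _ _ b m j) => //; exact: cube_corner_in.
  split=> // i k; rewrite (ord1 i) /ball/= distrC.
  by have /andP[? ?] := jy k; rewrite ger0_norm ?subr_ge0//; lra.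
have wU j y : cube j y -> w j <= U 0 y `^ q.
  move=> /osc; rewrite ltr_norml => /andP[A B].
  by rewrite /w ge_max powR_ge0/=; lra.
(* Going through the corner value costs the oscillation twice, that is [d / 4] after multiplication
   by [C]; with the [d / 2] of the power inequality this stays below [d]. *)
have Uw j y : cube j y -> U 0 y < d + C * w j.
  move=> /[dup] jy /osc; rewrite ltr_norml => /andP[_ B].
  have := dC _ (Ub 0 y h00).
  have A : U 0 (cube_corner j) `^ q - d / (8 * C) <= w j by rewrite /w le_max lexx orbT.
  have : C * U 0 y `^ q <= C * (w j + 2 * (d / (8 * C))) by rewrite ler_pM2l//; lra.
  have -> : C * (w j + 2 * (d / (8 * C))) = C * w j + d / 4 by field; rewrite gt_eqF.
  by move=> *; lra.
pose h : R := m%:R^-1; have h0 : 0 < h by rewrite invr_gt0.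
pose s := h ^+ 2; have s0 : 0 < s by rewrite exprn_gt0.
pose A0 := expR (- (N%:R / 2) * ln s).
(* For width [s = h^2] the peak height [s^(-N/2)] is the inverse of the cell volume. *)
have A0h : h ^+ N * A0 = 1.
  rewrite /A0 /s lnXn// -[ln h *+ 2]mulr_natl.
  have -> : - (N%:R / 2) * (2%:R * ln h) = - (ln h *+ N) by rewrite -[ln h *+ N]mulr_natl; field.
  by rewrite expRN -[ln h *+ N]mulr_natl expRM_natl lnK ?posrE// divff// expf_neq0// gt_eqF.
(* The amplitude for which the lower bound of the Gaussian on its own cube gives exactly
   [C * w j]. *)
pose a (j : J) := C * expR (N%:R / 4) * h ^+ N * w j.
have a0 j : 0 <= a j.
  by rewrite /a !mulr_ge0 ?expR_ge0 ?exprn_ge0// ltW.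
(* A solution of the heat equation: the paraboloid [|x|^2 + 2 N t] is caloric and scaled to reach
   [M2] on the lateral faces. The factor [exp (K t)] in [Z] then absorbs the nonlinearity. *)
pose Y t x := d + M2 / R1 ^+ 2 * (sqdist 0 x + 2 * N%:R * t) +
  \sum_j a j * gauss s (cube_corner j) t x.
pose Z t x := expR (K * t) * Y t x.
have K0 : 0 < K by rewrite /K ltr_wpDl ?powR_ge0.
have gauss0 t y (j : J) : 0 <= a j * gauss s (cube_corner j) t y.
  by rewrite mulr_ge0 ?a0// /gauss expR_ge0.
have sum0 t y : 0 <= \sum_j a j * gauss s (cube_corner j) t y.
  by apply: sumr_ge0 => j _; exact: gauss0.
have MR : 0 < M2 / R1 ^+ 2 by rewrite divr_gt0// exprn_gt0.
have YZ t y : 0 <= t -> 0 < Y t y -> Y t y <= Z t y.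
  by move=> t0 Y0; rewrite /Z ler_peMl ?(ltW Y0)// -expR0 ler_expR mulr_ge0// ltW.
have Yd t y : 0 <= t -> d <= Y t y.
  move=> t0; rewrite /Y -addrA lerDl addr_ge0 ?sum0// mulr_ge0 ?(ltW MR)//.
  by rewrite addr_ge0 ?sqdist_ge0// !mulr_ge0.
have Y0 t y : 0 <= t -> 0 < Y t y by move=> t0; exact: lt_le_trans (Yd _ _ t0).
suff UZ : U 2^-1 x < Z 2^-1 x.
  apply: (le_trans (ltW UZ)); apply: le_trans e1P; rewrite /Z ler_pM2l ?expR_gt0//.
  rewrite /Y !lerD// ?ler_wpM2l ?(ltW MR)//.
    rewrite lerD//; last by have -> : 2 * N%:R * 2^-1 = N%:R :> R by field.
    rewrite /sqdist; apply: (@le_trans _ _ (\sum_(i < N) r ^+ 2)).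
      apply: ler_sum => i _; rewrite -real_normK ?num_real//.
      by rewrite lerXn2r ?nnegrE// (le_trans _ (xr i)).
    by rewrite sumr_const card_ord mulr_natl.
  apply: (@le_trans _ _ (\sum_j a j * expR (N%:R / 2 * ln 2))).
    by apply: ler_sum => j _; rewrite ler_wpM2l// gauss_upper.
  rewrite -mulr_suml.
  have -> : \sum_j a j = C * expR (N%:R / 4) * \sum_j w j * h ^+ N.
    by rewrite mulr_sumr; apply: eq_bigr => j _; rewrite /a -!mulrA (mulrC (w j)).
  rewrite -mulrA (mulrC (\sum_j _)) mulrA ler_wpM2l//.
    by rewrite !mulr_ge0 ?expR_ge0// ltW.
  exact: LS.
apply: (@comparison _ _ p U Z 0 2^-1 R1 0) => //; last 2 first.
- lra.
- by move=> i; apply: le_trans (xr i) _.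
- by move=> t y tI _; exact: cU.
- move=> t y /andP[t0 _] _; rewrite /Z /jcont.
  have ts : 0 < t + s by rewrite ltr_wpDl.
  have cE : {for (t, y), continuous (fun z : R * 'rV[R]_N => expR (K * z.1))}.
    apply: (@jcont_time _ _ (fun t => expR (K * t))).
    apply: (@continuous_comp R R R (fun t => K * t) (@expR R)); last exact: continuous_expR.
    by apply: continuousM; [exact: cst_continuous|move=> ?].
  apply: (continuousM cE); rewrite /Y.
  have cS : {for (t, y), continuous (fun z : R * 'rV[R]_N =>
      \sum_j a j * gauss s (cube_corner j) z.1 z.2)}.
    apply: (@jcont_sum _ _ (fun j t y => a j * gauss s (cube_corner j) t y)) => j.
    by apply: continuousM; [exact: cst_continuous|exact: gauss_jcont].
  apply: continuousD cS; apply: continuousD; first exact: cst_continuous.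
  apply: continuousM; first exact: cst_continuous.
  apply: continuousD; first exact: jcont_sqdist.
  by apply: continuousM; [exact: cst_continuous|exact: cvg_fst].
- by move=> t y tI _; exact: subU.
- move=> y yR.
  have [j jy] : exists j : J, cube j y.
    apply: cube_cover => // i; have := yR i; rewrite mxE subr0 ler_norml => /andP[? ?].
    by apply/andP; split; lra.
  apply: lt_le_trans (YZ 0 y (lexx _) (Y0 _ _ (lexx _))).
  apply: lt_le_trans (Uw j y jy) _; rewrite /Y.
  apply: lerD; first by rewrite lerDl mulr_ge0 ?(ltW MR)// mulr0 addr0 sqdist_ge0.
  rewrite (bigD1 j)//= ler_wpDr//.
    by apply: sumr_ge0 => k _; exact: gauss0.
  have dist : sqdist (cube_corner j) y <= N%:R * s.
    apply: (@le_trans _ _ (\sum_(i < N) s)); last by rewrite sumr_const card_ord mulr_natl.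
    apply: ler_sum => i _; rewrite /s lerXn2r ?nnegrE ?(ltW h0)//.
      by have /andP[? ?] := jy i; rewrite subr_ge0.
    by have /andP[_ H] := jy i; rewrite lerBlDl ltW.
  apply: (@le_trans _ _ (a j * (A0 * expR (- (N%:R / 4))))); last first.
    by rewrite ler_wpM2l// gauss_lower.
  have -> // : a j * (A0 * expR (- (N%:R / 4))) = C * w j.
  have -> : a j * (A0 * expR (- (N%:R / 4))) =
    C * w j * (h ^+ N * A0) * (expR (N%:R / 4) * expR (- (N%:R / 4))) by rewrite /a; ring.
  by rewrite A0h -expRD subrr expR0 !mulr1.
- move=> t y i /andP[t0 t2] yR yi.
  have tI : 0 <= t <= 2^-1 by rewrite t0.
  have /andP[_ UM] := Ub t y tI; apply: le_lt_trans UM _.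
  apply: lt_le_trans (YZ t y t0 (Y0 _ _ t0)); rewrite /Y -addrA.
  apply: (@lt_le_trans _ _ (d + M2)); first by rewrite ltrDr.
  rewrite lerD2l ler_wpDr//.
  rewrite mulrAC ler_pdivlMr ?exprn_gt0// ler_pM2l// ler_wpDr ?mulr_ge0//.
  apply: le_trans (sqdist_coord 0 y i).
  by rewrite -yi -normrX ger0_norm ?sqr_ge0.
- move=> t y /andP[t0 _] _; have Yt := Y0 t y (ltW t0).
  exact: lt_le_trans (YZ _ _ (ltW t0) Yt).
move=> t y /andP[t0 t2] yR UZ.
have Yt := Y0 t y (ltW t0).
(* At contact [U^p <= M2^(p-1) U < K U]; the [+ 1] in [K] makes this strict. *)
exists (K * Z t y); last first.
  rewrite -UZ; have tI : 0 <= t <= 2^-1 by rewrite (ltW t0).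
  have /andP[U0 UM] := Ub t y tI.
  have U0' : 0 < U t y by rewrite UZ; exact: lt_le_trans (YZ _ _ (ltW t0) Yt).
  rewrite -mulr_powRB1//; last by rewrite (lt_trans ltr01).
  rewrite mulrC ltr_pM2r// /K ltr_pwDr//.
  by apply: ge0_ler_powR; rewrite ?nnegrE ?subr_ge0 ?(ltW p1) ?(ltW M20).
have ts : 0 < t + s by rewrite addr_gt0.
have Yd0 : heat_defect Y t y 0.
  rewrite -[X in heat_defect _ _ _ X](addr0 0); apply: heat_defectD; last first.
    by apply: heat_defect_sum => j; rewrite -(mulr0 (a j)); apply/heat_defectZ/gauss_defect.
  have Hd : heat_defect (fun _ (_ : 'rV[R]_N) => d) t y 0.
    exact: heat_defect_time (is_derive_cst d t 1).
  rewrite -[X in heat_defect _ _ _ X](addr0 0); apply: (heat_defectD Hd).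
  rewrite -(mulr0 (M2 / R1 ^+ 2)); apply: heat_defectZ.
  have -> : 0 = (0 - 4 * sqdist 0 y * 0 - 2 * N%:R * 1) + 2 * N%:R * 1 :> R by ring.
  apply: heat_defectD; last by apply: heat_defect_time; exact: is_derive_scalel.
  have nr : \forall r \near sqdist 0 y, is_derive r (1 : R) (fun r : R => r) 1.
    by near=> k; exact: is_derive_id.
  exact: (@heat_defect_radial _ _ (fun _ r => r) (fun=> 1) 0 0 t 0 y
    (is_derive_cst _ _ _) nr (is_derive_cst _ _ _)).
have dE : is_derive t (1 : R) (fun t => expR (K * t)) (expR (K * t) * K).
  apply: (@is_derive1_comp _ (@expR R) (fun t => K * t)).
  by apply: (is_derive_eq (is_derive_scalel K (is_derive_id t 1))); rewrite mulr1.
have := heat_defect_timeM dE Yd0.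
by rewrite mulr0 addr0 (mulrC _ K) -mulrA.
Unshelve. all: by end_near.
Qed.

End smoothing_estimate.

(** * Choice of constants and boundedness at unit scale *)

Section rescaled_theorem.
Context {R : realType}.

(** The witness solves [(4 e)^p = e / 2]. *)
Lemma small_fixed_point (p : R) : 1 < p -> exists2 e : R, 0 < e & (4 * e) `^ p <= e / 2.
Proof.
move=> p1; have p10 : 0 < p - 1 by rewrite subr_gt0.
have p0 : 0 < p by rewrite (lt_trans ltr01).
have A0 : 0 < 4 `^ p * 2 :> R by rewrite mulr_gt0// powR_gt0.
pose e : R := (4 `^ p * 2) `^ (- (p - 1)^-1).
have e0 : 0 < e by rewrite powR_gt0.
exists e => //.
have E : e `^ (p - 1) = (4 `^ p * 2)^-1.
  by rewrite /e -powRrM mulNr mulVf ?gt_eqF// powR_inv1// ltW.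
rewrite powRM ?(ltW e0)// -(mulr_powRB1 (ltW e0) p0) E invfM.
rewrite mulrCA (mulrA (4 `^ p)) mulfV ?mul1r// gt_eqF// powR_gt0//.
Qed.

Lemma ler_square (x : R) : 1 <= x -> x <= x ^+ 2.
Proof. by move=> x1; rewrite expr2 ler_peMr// (le_trans ler01). Qed.

(** Stating smallness through lower sums keeps measure theory out of the comparison arguments. The
    constants are fixed in the order [e1], [n], [ee], [r], [d], [C], [R1], [b], [eta], hence depend
    on [M], [p] and [N] only. *)
Theorem rescaled_epsilon_regularity (N : nat) (p M : R) :
  (0 < N)%N -> 1 < p -> 0 < M ->
  exists (eta : R) (b : nat), [/\ 0 < eta, (0 < b)%N &
  forall U : R -> 'rV[R]_N -> R,
  (forall t x, 0 <= t < 1 -> jcont U t x) ->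
  (forall t x, 0 < t < 1 -> 0 < U t x -> subsolution p U t x) ->
  (forall t x, 0 <= t < 1 -> 0 <= U t x <= M * (1 - t) `^ (- (p - 1)^-1)) ->
  (forall (m : nat) (w : {ffun 'I_N -> 'I_(2 * b * m)} -> R), (0 < m)%N ->
     (forall j, 0 <= w j) ->
     (forall j x, cube j x -> w j <= U 0 x `^ (N%:R * (p - 1) / 2)) ->
     \sum_j w j * m%:R^-1 ^+ N <= eta) ->
  exists (r C : R), 0 < r /\ forall t x, 2^-1 <= t < 1 -> box 0 r x -> U t x <= C].
Proof.
move=> N0 p1 M0; have p10 : 0 < p - 1 by rewrite subr_gt0.
pose q : R := N%:R * (p - 1) / 2.
have q0 : 0 < q by rewrite divr_gt0// mulr_gt0// ltr0n.
have [e1 e10 e1p] := small_fixed_point p1.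
have Mp0 := powR_ge0 M (p - 1).
have p1V : 0 < (p - 1)^-1 by rewrite invr_gt0.
have [n nbig] : exists n, 2 * M `^ (p - 1) + 1 + (p - 1)^-1 < n.+1%:R.
  by eexists; apply: real_truncnS_gt; exact: num_real.
pose D : R := n.+2%:R * (4 * n.+1%:R + 2 * N%:R).
have D0 : 0 < D by rewrite mulr_gt0// addr_gt0// mulr_gt0// ltr0n.
pose ee := e1 / (4 * D ^+ n.+2).
have ee0 : 0 < ee by rewrite divr_gt0// mulr_gt0// exprn_gt0.
have eeD : ee * D ^+ n.+2 < e1 / 2.
  have -> : ee * D ^+ n.+2 = e1 / 4.
    rewrite /ee; have := lt0r_neq0 (exprn_gt0 n.+2 D0).
    by move: (D ^+ n.+2) => X X0; field.
  by lra.
(* As [r >= 1], the high power [r^(2 (n+2))] is at least [r], hence at least [M / ee]. *)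
pose r := M / ee + 1.
have r1 : 1 <= r by rewrite lerDr divr_ge0// ltW.
have r0 : 0 < r by rewrite (lt_le_trans ltr01).
have rM : M <= ee * r ^+ 2 ^+ n.+2.
  rewrite -exprM mulrC -ler_pdivrMr//; apply: (@le_trans _ _ r); first by rewrite lerDl.
  by apply: ler_eXnr => //; rewrite muln_gt0.
pose M2 := M * 2^-1 `^ (- (p - 1)^-1).
have M20 : 0 < M2 by rewrite mulr_gt0// powR_gt0.
pose K := M2 `^ (p - 1) + 1; pose E := expR (K / 2).
have E0 : 0 < E by exact: expR_gt0.
(* Three equal shares of [e1 / E]: the constant, the paraboloid at time 1/2, and the Gaussians, for
   which [eta] is taken to be [d / c]. *)
pose d := e1 / (3 * E); have d0 : 0 < d by rewrite divr_gt0// mulr_gt0.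
have [C C0 HC] := powR_dominates_near0 M2 q0 (divr_gt0 d0 (ltr0n _ 2)).
pose Q := N%:R * (2 * r) ^+ 2 + N%:R.
have Q0 : 0 <= Q by rewrite addr_ge0// mulr_ge0// sqr_ge0.
(* Large enough for [M2 Q / R1^2 <= d], using [R1 <= R1^2]. *)
pose R1 := 2 * r + M2 * Q / d.
have R1r : 2 * r <= R1 by rewrite lerDl divr_ge0 ?(ltW d0)// mulr_ge0// ltW.
have R11 : 1 <= R1 by lra.
have R10 : 0 < R1 by lra.
have [b R1b] : exists b, R1 < b.+1%:R.
  by eexists; apply: real_truncnS_gt; exact: num_real.
pose c := C * expR (N%:R / 4) * expR (N%:R / 2 * ln 2).
have c0 : 0 < c by rewrite !mulr_gt0 ?expR_gt0.
exists (d / c), b.+1; split => //; first by rewrite divr_gt0.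
move=> U cU subU typeI LS; exists r, (2 * e1); split => //.
have tI (t : R) : 0 <= t <= 2^-1 -> 0 <= t < 1.
  by move=> /andP[? ?]; apply/andP; split; lra.
(* The later barrier is centred at any [x] of the box of half-side [r] and needs smallness on a box
   of half-side [r] about [x], whence the doubling. *)
have half (x : 'rV[R]_N) : box 0 (2 * r) x -> U 2^-1 x <= e1.
  apply: (@smoothing_estimate R N p q M2 d C e1 (d / c) R1 (2 * r) b.+1 U) => //.
  - rewrite -/K -/E -/Q -/c [c * _]mulrC divfK ?gt_eqF//.
    have : M2 / R1 ^+ 2 * Q <= d.
      rewrite mulrAC ler_pdivrMr ?exprn_gt0// -ler_pdivrMl// mulrC.
      apply: le_trans (ler_square R11); rewrite /R1 lerDr; lra.
    have -> : e1 = E * (d + d + d) by rewrite /d; field; rewrite gt_eqF.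
    by move=> ?; rewrite ler_pM2l//; lra.
  - by move=> t y /tI; exact: cU.
  - by move=> t y /andP[t0 t2]; apply: subU; rewrite t0; lra.
  - move=> t y t2; have /andP[-> /= H] := typeI t y (tI t t2).
    apply: le_trans H _; rewrite /M2 ler_pM2l// !powRN lef_pV2 ?posrE ?powR_gt0//.
      by apply: ge0_ler_powR; rewrite ?nnegrE ?(ltW p1V)//; case/andP: t2 => *; lra.
    by case/andP: t2 => *; lra.
move=> t x t2 xr.
apply: (@small_data_bounded R N p M e1 ee r n U x) => //; try lra.
- by move=> s y /andP[s2 s1]; apply: cU; rewrite s1 andbT; lra.
- by move=> s y /andP[s2 s1]; apply: subU; rewrite s1 andbT; lra.
- by move=> s y /andP[s2 s1]; apply: typeI; rewrite s1 andbT; lra.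
move=> y yx; apply: half => i.
have -> : y ord0 i - (0 : 'rV[R]_N) ord0 i =
  (y ord0 i - x ord0 i) + (x ord0 i - (0 : 'rV[R]_N) ord0 i) by ring.
by apply: le_trans (ler_normD _ _) _; have := yx i; have := xr i; lra.
Qed.

End rescaled_theorem.

(** * Measurability of open sets and Lebesgue measure of cubes *)

Section lebesgue_rV_facts.
Context {R : realType} {N : nat}.
Implicit Types (A : set 'rV[R]_N) (x y c : 'rV[R]_N) (f : 'rV[R]_N -> R).

Lemma measurable_rV_prod (A : 'I_N -> set R) : (forall i, measurable (A i)) ->
  measurable [set x : 'rV[R]_N | forall i, A i (x ord0 i)].
Proof.
move=> mA.
rewrite (_ : mkset _ = \bigcap_i ((fun x : 'rV[R]_N => x ord0 i) @^-1` A i)).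
  apply: fin_bigcap_measurable => [|i _]; first exact: finite_finset.
  by rewrite -[X in measurable X]setTI; apply: measurable_coord => //; exact: mA.
by apply/seteqP; split=> x h i; [move=> _|]; exact: h.
Qed.

Lemma measurable_cube_rV c (h : R) :
  measurable [set x : 'rV[R]_N | forall i, c ord0 i <= x ord0 i < c ord0 i + h].
Proof.
rewrite (_ : mkset _ = [set x : 'rV[R]_N | forall i, [set` `[c ord0 i, c ord0 i + h[] (x ord0 i)]).
  by apply: (measurable_rV_prod (A := fun i => [set` `[c ord0 i, c ord0 i + h[])).
by apply/seteqP; split => x /= H i; have := H i; rewrite in_itv.
Qed.

Lemma lebesgue_cube_rV c (h : R) : 0 <= h ->
  lebesgue_rV N [set x : 'rV[R]_N | forall i, c ord0 i <= x ord0 i < c ord0 i + h]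
  = (h ^+ N)%:E.
Proof.
move=> h0.
transitivity (lebesgue_rV N [set x : 'rV[R]_N | forall i, [set` `[c ord0 i, c ord0 i + h[] (x ord0 i)]).
  by congr (lebesgue_rV N _); apply/seteqP; split => x /= H i; have := H i; rewrite in_itv.
rewrite (lebesgue_rV_box (A := fun i => [set` `[c ord0 i, c ord0 i + h[]))//.
rewrite (eq_bigr (fun=> h%:E)); last first.
  move=> i _; rewrite lebesgue_measure_itv/= lte_fin ltrDl.
  have [_|h0'] := ltP 0 h; first by rewrite -EFinB addrC addKr.
  by congr EFin; apply/eqP; rewrite eq_le h0 h0'.
by rewrite prodEFin prodr_const card_ord.
Qed.

Lemma rV_ball_box c (r : R) : 0 < r -> ball c r = [set x | forall i, `|x ord0 i - c ord0 i| < r].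
Proof.
move=> r0; apply/seteqP; split => [x [_ H] i|x H].
  by rewrite distrC; exact: H.
by split => // i j; rewrite (ord1 i) /ball/= distrC; exact: H.
Qed.

Lemma open_ball_sub A x : open A -> A x -> exists2 d : R, 0 < d & ball x d `<=` A.
Proof.
by move=> oA Ax; have /nbhs_ballP[d d0 dA] : nbhs x A by [exact: open_nbhs_nbhs]; exists d.
Qed.

Lemma dist_lt_itv (a q k : R) : a < q < a + k -> `|a - q| < k.
Proof. by rewrite ltr_norml => /andP[? ?]; apply/andP; split; lra. Qed.

Lemma dist_lt_triangle (a q y k d : R) :
  a < q < a + k -> `|y - q| < k -> k < d / 2 -> `|y - a| < d.
Proof.
by rewrite !ltr_norml => /andP[? ?] /andP[? ?] ?; apply/andP; split; lra.
Qed.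

(** The sigma-algebra is generated by the coordinates, so [A] is written as a countable union of
    boxes with rational centres and radii [1 / (k + 1)]; boxes not inside [A] are replaced by the
    empty set. *)
Lemma open_measurable_rV A : open A -> measurable A.
Proof.
move=> oA.
pose bx (z : 'rV[rat]_N * nat) : set 'rV[R]_N :=
  ball (\row_i (ratr (z.1 ord0 i) : R)) (z.2.+1%:R^-1).
pose F z := if `[< bx z `<=` A >] then bx z else set0.
have -> : A = \bigcup_z F z.
  apply/seteqP; split => [x Ax|x [z _]]; last first.
    by rewrite /F; case: asboolP => // zA; exact: zA.
  have [d d0 dA] : exists2 d : R, 0 < d & ball x d `<=` A by exact: open_ball_sub.
  pose k := Num.truncn (2 / d).
  have k0 : 0 < k.+1%:R^-1 :> R by rewrite invr_gt0.
  have kd : k.+1%:R^-1 < d / 2.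
    by rewrite -[ltRHS]invrK ltf_pV2 ?posrE ?invr_gt0 ?divr_gt0// invf_div real_truncnS_gt// num_real.
  have H i : {q : rat | x ord0 i < ratr q < x ord0 i + k.+1%:R^-1}.
    apply/cid; have [|q] := @rat_in_itvoo R (x ord0 i) (x ord0 i + k.+1%:R^-1).
      by rewrite ltrDl.
    by rewrite in_itv/= => ?; exists q.
  exists (\row_i sval (H i), k) => //; rewrite /F.
  have bxx y : bx (\row_i sval (H i), k) y <->
      forall i, `|y ord0 i - ratr (sval (H i))| < k.+1%:R^-1.
    rewrite /bx rV_ball_box//=.
    by split => Hy i; have := Hy i; rewrite !mxE.
  rewrite asboolT; last first.
    move=> y /bxx Hy; apply: dA; rewrite rV_ball_box// => i.
    exact: dist_lt_triangle (svalP (H i)) (Hy i) kd.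
  by apply/bxx => i; exact: dist_lt_itv (svalP (H i)).
apply: countable_bigcupT_measurable => // z; rewrite /F; case: asboolP => // _.
pose I i := [set` `]ratr (z.1 ord0 i) - z.2.+1%:R^-1, ratr (z.1 ord0 i) + z.2.+1%:R^-1[] : set R.
have -> : bx z = [set x : 'rV[R]_N | forall i, I i (x ord0 i)].
  rewrite /bx rV_ball_box ?invr_gt0//.
  by apply/seteqP; split => x /= Hx i; have := Hx i; rewrite /I /= in_itv/= ltr_distl mxE.
by apply: (measurable_rV_prod (A := I)) => i; exact: measurable_itv.
Qed.

Lemma continuous_measurable_rV f : continuous f -> measurable_fun setT f.
Proof.
move=> cf; apply: (measurability _ (RGenOpens.measurableE R)) => //.
move=> _ [_ [a [b ->] <-]]; rewrite setTI; apply: open_measurable_rV.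
by move/continuousP: cf; apply; exact: interval_open.
Qed.

Lemma open_lebesgue_gt0 A : open A -> A !=set0 -> (0 < lebesgue_rV N A)%E.
Proof.
move=> oA [x Ax].
have [d d0 dA] : exists2 d : R, 0 < d & ball x d `<=` A by exact: open_ball_sub.
have d20 : 0 < d / 2 by rewrite divr_gt0.
have := lebesgue_cube_rV x (ltW d20); set Q := mkset _ => QE.
apply: (@lt_le_trans _ _ (lebesgue_rV N Q)); first by rewrite QE lte_fin exprn_gt0.
apply: le_measure; rewrite ?inE; [exact: measurable_cube_rV|exact: open_measurable_rV|].
move=> y Qy; apply: dA; rewrite rV_ball_box// => i; have /andP[? ?] := Qy i.
by rewrite ltr_norml; apply/andP; split; lra.
Qed.

(** Nonempty open sets have positive measure, so an essential bound on a continuous function holds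
    at every point; this makes the type I estimate pointwise. *)
Lemma Linfty_norm_continuous (Omega : set 'rV[R]_N) f (B : R) :
  continuous (f \_ Omega) -> (Linfty_norm Omega f <= B%:E)%E ->
  forall x, `|(f \_ Omega) x| <= B.
Proof.
move=> cf; rewrite /Linfty_norm unlock /=.
rewrite open_lebesgue_gt0//; [|exact: openT|by exists 0].
move=> /ess_supP Bae x; rewrite leNgt; apply/negP => Bx.
pose O := [set y | B < `|(f \_ Omega) y|].
have oO : open O.
  rewrite (_ : O = (fun y => `|(f \_ Omega) y|) @^-1` [set r | B < r])//.
  apply: (continuousP _).1; last exact: open_gt.
  by move=> y; apply: (@continuous_comp _ _ _ (f \_ Omega) (@Num.norm _ R));
    [exact: cf|exact: norm_continuous].
have : (0 < lebesgue_rV N O)%E by apply: open_lebesgue_gt0 => //; exists x.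
have : (lebesgue_rV N).-negligible O.
  apply: negligibleS Bae => y; rewrite /O /= lee_fin => By; apply/negP.
  by rewrite -ltNge.
by move/(negligibleP (lebesgue_rV N) (open_measurable_rV oO)) => ->; rewrite ltxx.
Qed.

End lebesgue_rV_facts.

(** * Directional derivatives and parabolic rescaling *)

Section extension_by_zero.
Context {R : realType} {N : nat}.
Implicit Types (U : R -> 'rV[R]_N -> R) (x y a : 'rV[R]_N).

Lemma is_derive_line (f : 'rV[R]_N -> R) x v (h : R) :
  derivable f (x + h *: v) v ->
  is_derive h (1 : R) (fun h => f (x + h *: v)) ('D_v f (x + h *: v)).
Proof.
move=> df; set g := fun h => f (x + h *: v).
have E : (fun k : R => k^-1 *: ((g \o shift h) (k *: (1 : R)) - g h)) =
    (fun k : R => k^-1 *: ((f \o shift (x + h *: v)) (k *: v) - f (x + h *: v))).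
  apply/funext => k; rewrite /g /shift /=; congr (_ *: (f _ - _)).
  by rewrite -[k *: (1 : R)]/(k * 1) mulr1 scalerDl addrC -addrA (addrC (h *: v)).
by apply: DeriveDef; rewrite ?/derivable ?/derive E.
Qed.

Lemma jcont_norm U (t : R) x : jcont U t x -> jcont (fun t x => `|U t x|) t x.
Proof.
move=> cU; apply: (@continuous_comp _ _ _ (fun z : R * 'rV[R]_N => U z.1 z.2) (@Num.norm _ R)).
  exact: cU.
exact: norm_continuous.
Qed.

Lemma jcont_rescale U (t0 L l k : R) a (s : R) y : 0 < L -> 0 < k -> 0 < l ->
  jcont U (t0 + L * s) (a + k *: y) ->
  jcont (fun s y => l * U (t0 + L * s) (a + k *: y)) s y.
Proof.
move=> L0 k0 l0 /jcontP cU; apply/jcontP => e e0.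
have [d d0 H] := cU _ (divr_gt0 e0 l0).
exists (Num.min (d / L) (d / k)); first by rewrite lt_min !divr_gt0.
move=> s' y'; rewrite lt_min => /andP[Hs _] Hy.
rewrite -mulrBr normrM gtr0_norm// mulrC -ltr_pdivlMr//; apply: H => [|i].
  have -> : t0 + L * s' - (t0 + L * s) = L * (s' - s) by ring.
  by rewrite normrM gtr0_norm// mulrC -ltr_pdivlMr.
have := Hy i; rewrite lt_min => /andP[_ Hyi]; rewrite !mxE.
have -> : a ord0 i + k * y' ord0 i - (a ord0 i + k * y ord0 i) = k * (y' ord0 i - y ord0 i) by ring.
by rewrite normrM gtr0_norm// mulrC -ltr_pdivlMr.
Qed.

(** Under [k^2 = L] and [l^p = l L] the three terms of the inequality all scale by [l L], so test
    data [z], [c] for the rescaled function become [z / (l L)], [c / (l L)] for [U]. *)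
Lemma subsolution_rescale (p : R) U (t0 L l k : R) a (s : R) y :
  0 < L -> 0 < k -> 0 < l -> k ^+ 2 = L -> l `^ p = l * L ->
  (forall t x, 0 <= U t x) ->
  subsolution p U (t0 + L * s) (a + k *: y) ->
  subsolution p (fun s y => l * U (t0 + L * s) (a + k *: y)) s y.
Proof.
move=> L0 k0 l0 kL lp U0 subU z c Hz Hc.
have lL0 : 0 < l * L by rewrite mulr_gt0.
have L0' : L != 0 by rewrite gt_eqF.
have l0' : l != 0 by rewrite gt_eqF.
have -> : z = (l * L) * (z / (l * L)) by field; rewrite L0' l0'.
rewrite powRM ?(ltW l0)// lp.
have -> : \sum_i c i = (l * L) * \sum_i (c i / (l * L)).
  by rewrite -mulr_suml mulrC divfK ?gt_eqF.
rewrite -mulrDr ler_pM2l//; apply: subU => [e e0|i e e0].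
  have [d d0 H] := Hz _ (mulr_gt0 e0 lL0).
  exists (d * L); first exact: mulr_gt0.
  move=> t' /andP[t1 t2].
  have := H ((t' - t0) / L).
  have -> : t0 + L * ((t' - t0) / L) = t' by field.
  have -> : s - d < (t' - t0) / L < s.
    by rewrite ltr_pdivlMr// ltr_pdivrMr//; apply/andP; split; lra.
  move=> /(_ isT).
  have -> : (z - e * (l * L)) * ((t' - t0) / L - s) =
    l * ((z / (l * L) - e) * (t' - (t0 + L * s))) by field; rewrite L0' l0'.
  by rewrite -mulrBr ler_pM2l.
have [d d0 H] := Hc i _ (mulr_gt0 e0 lL0).
exists (d * k); first exact: mulr_gt0.
move=> h /andP[h0 hd]; have := H (h / k).
rewrite divr_gt0// ltr_pdivrMr// hd => /(_ isT).
have kh : k * (h / k) = h by field; rewrite gt_eqF.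
rewrite !scalerDr scalerN !scalerA kh !addrA.
have -> : (c i + e * (l * L)) * (h / k) ^+ 2 = l * ((c i / (l * L) + e) * h ^+ 2).
  by rewrite -kL; field; rewrite l0' gt_eqF.
have -> (A B C : R) : l * A + l * B - 2 * (l * C) = l * (A + B - 2 * C) by ring.
by rewrite ler_pM2l.
Qed.

End extension_by_zero.

(** * The modulus of a classical solution, extended by zero *)

Section classical_solution_facts.
Context {R : realType} {N : nat}.
Variables (p : R) (Omega : set 'rV[R]_N) (u0 : 'rV[R]_N -> R) (T : R).
Variable u : R -> 'rV[R]_N -> R.
Hypothesis oOmega : open Omega.
Hypothesis p0 : 0 < p.
Hypothesis sol : classical_solution p Omega u0 T%:E u.

Let V (t : R) : 'rV[R]_N -> R := u t \_ Omega.

Let VE t x : Omega x -> V t x = u t x.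
Proof. by move=> Ox; rewrite /V patchE mem_set. Qed.

Let VN t x : ~ Omega x -> V t x = 0.
Proof. by move=> Ox; rewrite /V patchE memNset. Qed.

(** Continuity of [u] up to the boundary is given within the closure of [Omega] only; the zero
    boundary value is what glues it to the zero extension. *)
Lemma extension_jcont (t : R) x : 0 < t < T -> jcont V t x.
Proof.
move=> /andP[t0 tT]; apply/jcontP => e e0.
have [cx|ncx] := pselect (closure Omega x); last first.
  have [d d0 dO] : exists2 d : R, 0 < d & ball x d `<=` ~` closure Omega.
    by apply: open_ball_sub => //; exact/closed_openC/closed_closure.
  exists d => // s y _ Hy.
  have nO y' : ball x d y' -> ~ Omega y'.
    by move=> /dO ncy Oy; apply: ncy; exact: subset_closure.
  rewrite !VN ?subrr ?normr0//; first by apply: nO; exact: ballxx.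
  by apply: nO; rewrite rV_ball_box.
set S := [set z : R * 'rV[R]_N | [/\ 0 < z.1, (z.1%:E < T%:E)%E & closure Omega z.2]].
have := (subspace_continuousP S (fun z : R * 'rV[R]_N => u z.1 z.2)).1 (cs_continuous sol) (t, x).
have Stx : S (t, x) by split.
move=> /(_ Stx) /cvgrPdist_lt/(_ e e0); rewrite near_withinE => /near_rVP[d d0 H].
have [d1 d10 Hd1] : exists2 d1 : R, 0 < d1 &
    forall (s : R) (y : 'rV[R]_N), `|s - t| < d1 -> (forall i, `|y ord0 i - x ord0 i| < d1) ->
      Omega y -> `|u s y - u t x| < e.
  exists (Num.min d (Num.min t (T - t))).
    by rewrite !lt_min d0 t0 subr_gt0.
  move=> s y; rewrite !lt_min => /and3P[sd]; rewrite ltr_norml => /andP[st _].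
  rewrite ltr_norml => /andP[_ sT] Hy Oy; rewrite distrC; apply: (H s y) => //=.
    by move=> i; have := Hy i; rewrite lt_min => /andP[].
  by split => /=; [lra|rewrite lte_fin; lra|exact: subset_closure].
have [Ox|nOx] := pselect (Omega x).
  have [d2 d20 d2O] := open_ball_sub oOmega Ox.
  exists (Num.min d1 d2); first by rewrite lt_min d10.
  move=> s y; rewrite lt_min => /andP[sd _] Hy.
  have Oy : Omega y.
    by apply: d2O; rewrite rV_ball_box// => i; have := Hy i; rewrite lt_min => /andP[].
  by rewrite !VE//; apply: Hd1 => // i; have := Hy i; rewrite lt_min => /andP[].
have bx : boundary Omega x.
  by split => //; rewrite (interior_id _).1.
have ux : u t x = 0 by apply: (cs_boundary sol).
exists d1 => // s y sd Hy; rewrite (VN t nOx).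
have [Oy|nOy] := pselect (Omega y); last by rewrite VN// subrr normr0.
by rewrite VE// -[X in _ - X]ux; exact: Hd1.
Qed.

(** Kato's inequality in test form: with the sign [sg] frozen at the point, [sg * u] lies below
    [|V|] in [Omega] and agrees with it at [(t, x)]. Upper bounds on differences of [|V|] thus pass
    to [sg * u], whose derivatives exist and satisfy the equation. *)
Lemma extension_subsolution (t : R) x : 0 < t < T -> 0 < `|V t x| ->
  subsolution p (fun t x => `|V t x|) t x.
Proof.
move=> /andP[t0 tT] Vx.
have Ox : Omega x by apply: contrapT => /(VN t) V0; move: Vx; rewrite V0 normr0 ltxx.
have [_ dt _ _ _] := cs_C12 sol t0 tT Ox.
have dtx : is_derive t (1 : R) (u ^~ x) (laplacian (u t) x + `|u t x| `^ (p - 1) * u t x).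
  apply: DeriveDef => //; rewrite -derive1E.
  exact: (cs_equation sol).
set Dt := laplacian _ _ + _ in dtx.
have u0' : u t x != 0 by rewrite -(VE t Ox) -normr_gt0.
pose sg : R := Num.sg (u t x).
have sgu : sg * u t x = `|u t x| by rewrite normrEsg.
have sgn : `|sg| = 1 by rewrite normr_sg u0'.
have sgV s y : Omega y -> sg * u s y <= `|V s y|.
  by move=> Oy; rewrite VE// (le_trans (ler_norm _))// normrM sgn mul1r.
have sgle (X Y : R) : `|X| <= Y -> - Y <= sg * X.
  move=> XY; have : `|sg * X| <= Y by rewrite normrM sgn mul1r.
  by rewrite ler_norml => /andP[].
have Vtx : `|V t x| = sg * u t x by rewrite VE.
move=> z c Hz Hc.
have zD : z <= sg * Dt.
  apply/ler_addgt0Pr => e e0; have e20 : 0 < e / 2 by rewrite divr_gt0.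
  have [d d0 Hd] := Hz _ e20; have [d1 d10 Hd1] := is_derive_epsilon dtx e20.
  pose r := Num.min d d1 / 2.
  have r0 : 0 < r by rewrite divr_gt0// lt_min d0.
  have rd : r < d.
    have : Num.min d d1 <= d by rewrite ge_min lexx.
    by rewrite /r => ?; lra.
  have rd1 : r < d1.
    have : Num.min d d1 <= d1 by rewrite ge_min lexx orbT.
    by rewrite /r => ?; lra.
  have := Hd (t - r); rewrite ltrD2l ltrN2 rd gtrBl r0 => /(_ isT).
  have -> : t - r - t = - r by ring.
  have := Hd1 (- r); rewrite normrN gtr0_norm// => /(_ rd1) /sgle B.
  have := sgV (t - r) x Ox; rewrite Vtx => A C.
  rewrite -(ler_pM2l r0).
  have -> : r * (sg * Dt + e) = r * z + (r * (sg * Dt + e) - r * z) by ring.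
  have E : sg * (u (t - r) x - u t x - Dt * - r) = sg * u (t - r) x - sg * u t x + sg * Dt * r by ring.
  rewrite E in B; rewrite lerDl; lra.
have cD i : sg * partial i (partial i (u t)) x <= c i.
  apply/ler_addgt0Pr => e e0; have e20 : 0 < e / 2 by rewrite divr_gt0.
  set v : 'rV[R]_N := delta_mx ord0 i.
  have [d2 d20 d2O] := open_ball_sub oOmega Ox.
  have inO h : `|h| < d2 -> Omega (x + h *: v).
    move=> hd; apply: d2O; rewrite rV_ball_box// => j; rewrite /v !mxE eqxx /=.
    rewrite addrAC subrr add0r.
    by case: (j == i); rewrite ?mulr1 ?mulr0 ?normr0.
  have H1 : \forall h \near (0 : R), is_derive h (1 : R) (fun h => u t (x + h *: v))
      (partial i (u t) (x + h *: v)).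
    apply/near0P; exists d2 => // h /inO Oh; apply: is_derive_line.
    by have [_ _ _ /(_ i)[]] := cs_C12 sol t0 tT Oh.
  have x0 : x + (0 : R) *: v = x by rewrite scale0r addr0.
  have H2 : is_derive (0 : R) (1 : R) (fun h => partial i (u t) (x + h *: v))
      (partial i (partial i (u t)) x).
    rewrite -[X in partial i (partial i (u t)) X]x0; apply: is_derive_line; rewrite x0.
    by have [_ _ _ _ /(_ i i)[]] := cs_C12 sol t0 tT Ox.
  have [d d0 Hd] := Hc i _ e20; have [d1 d10 Hd1] := sym_second_difference H1 H2 e20.
  pose r := Num.min d (Num.min d1 d2) / 2.
  have m0 : 0 < Num.min d (Num.min d1 d2) by rewrite !lt_min d0 d10.
  have r0 : 0 < r by rewrite divr_gt0.
  have : r < Num.min d (Num.min d1 d2) by rewrite /r; lra.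
  rewrite !lt_min => /and3P[rd rd1 rd2].
  have r20 : 0 < r ^+ 2 by rewrite exprn_gt0.
  have := Hd r; rewrite r0 rd => /(_ isT).
  have := Hd1 r; rewrite r0 rd1 => /(_ isT); rewrite /= x0 scaleNr -/v => /sgle B C.
  have := sgV t (x + r *: v) (inO _ _); rewrite gtr0_norm// => /(_ rd2) A1.
  have := sgV t (x - r *: v); rewrite -scaleNr => /(_ (inO _ _)).
  rewrite normrN gtr0_norm// => /(_ rd2); rewrite scaleNr => A2.
  rewrite Vtx in C.
  set D := partial _ _ _ in B *.
  rewrite -(ler_pM2r r20).
  have E : sg * (u t (x + r *: v) + u t (x - r *: v) - 2 * u t x - D * r ^+ 2) =
    sg * u t (x + r *: v) + sg * u t (x - r *: v) - 2 * (sg * u t x) - sg * D * r ^+ 2 by ring.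
  rewrite E in B; move: (sg * D) B => X B; lra.
apply: (le_trans zD); rewrite /Dt mulrDr /laplacian mulr_sumr lerD//.
  by apply: ler_sum => i _; exact: cD.
by rewrite mulrCA sgu VE// mulrC mulr_powRB1.
Qed.

End classical_solution_facts.

(** * Lower Riemann sums against the Lebesgue integral *)

Section lower_sums.
Context {R : realType} {N : nat}.

Lemma measurable_box (b : 'rV[R]_N) (r : R) : measurable (box b r).
Proof.
rewrite (_ : box b r = [set x : 'rV[R]_N | forall i, [set` `[b ord0 i - r, b ord0 i + r]] (x ord0 i)]).
  by apply: (measurable_rV_prod (A := fun i => [set` `[b ord0 i - r, b ord0 i + r]])).
by apply/seteqP; split => x /= H i; have := H i; rewrite in_itv/= ler_distl.
Qed.

Lemma lower_sum_le_integral (f : 'rV[R]_N -> R) (a : 'rV[R]_N) (k : R) (b m : nat)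
    (w : {ffun 'I_N -> 'I_(2 * b * m)} -> R) :
  continuous f -> (forall x, 0 <= f x) -> 0 < k -> (0 < m)%N ->
  (forall j, 0 <= w j) -> (forall j x, cube j x -> w j <= f (a + k *: x)) ->
  ((\sum_j w j * (k / m%:R) ^+ N)%:E <=
    \int[lebesgue_rV N]_(x in box a (k * b%:R)) (f x)%:E)%E.
Proof.
move=> cf f0 k0 m0 w0 wf.
have m0' : 0 < m%:R :> R by rewrite ltr0n.
pose c (j : {ffun 'I_N -> 'I_(2 * b * m)}) : 'rV[R]_N := a + k *: cube_corner j.
pose Q (j : {ffun 'I_N -> 'I_(2 * b * m)}) : set 'rV[R]_N :=
  [set x | forall i, c j ord0 i <= x ord0 i < c j ord0 i + k / m%:R].
have km : 0 <= k / m%:R by rewrite divr_ge0// ltW.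
have mQ j : measurable (Q j) by exact: measurable_cube_rV.
have Qcube j x : Q j x -> cube j (k^-1 *: (x - a)).
  move=> Qx i; have := Qx i.
  have -> : c j ord0 i = a ord0 i + k * cube_corner j ord0 i.
    by rewrite /c !mxE.
  have -> : (k^-1 *: (x - a)) ord0 i = (x ord0 i - a ord0 i) / k by rewrite !mxE mulrC.
  move: (cube_corner j ord0 i) => z; rewrite ler_pdivlMr// ltr_pdivrMr//.
  have -> : (z + m%:R^-1) * k = k * z + k / m%:R by ring.
  by rewrite mulrC => /andP[? ?]; apply/andP; split; lra.
have Qbox j : Q j `<=` box a (k * b%:R).
  move=> x /Qcube /(cube_sub_box m0) H i; have := H i.
  rewrite !mxE subr0 normrM gtr0_norm ?invr_gt0//.
  by rewrite mulrC ler_pdivrMr// (mulrC k).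
have tQ : trivIset [set` index_enum {ffun 'I_N -> 'I_(2 * b * m)}] Q.
  move=> j j' _ _ [x [/Qcube jx /Qcube j'x]].
  apply/ffunP => i; apply/val_inj => /=; apply/eqP.
  have := jx i; have := j'x i; rewrite ![cube_corner _ _ _]mxE.
  move: ((k^-1 *: (x - a)) ord0 i) => y /andP[A B] /andP[C D].
  (* A point common to two half-open cubes bounds each index by the other. *)
  have lem (n n' : nat) : - b%:R + n%:R / m%:R <= y -> y < - b%:R + n'%:R / m%:R + m%:R^-1 -> (n <= n')%N.
    move=> E F; rewrite -ltnS -(ltr_nat R) -(ltr_pM2r (_ : 0 < m%:R^-1 :> R)) ?invr_gt0//.
    by rewrite -natr1 mulrDl mul1r; lra.
  by rewrite eqn_leq (lem _ _ C B) (lem _ _ A D).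
have mf (D : set 'rV[R]_N) : measurable_fun D (fun x => (f x)%:E).
  apply: measurable_funTS; apply/measurable_EFinP.
  exact: continuous_measurable_rV.
set D := \big[setU/set0]_(j <- index_enum {ffun 'I_N -> 'I_(2 * b * m)}) Q j.
have mD : measurable D by apply: bigsetU_measurable => j _; exact: mQ.
apply: (@le_trans _ _ (\int[lebesgue_rV N]_(x in D) (f x)%:E)%E); last first.
  apply: ge0_subset_integral => //; first exact: measurable_box.
    by move=> x _; rewrite lee_fin.
  by rewrite /D => x; rewrite -bigcup_seq => -[j _]; exact: Qbox.
rewrite ge0_integral_bigsetU//; last 2 first.
- exact: index_enum_uniq.
- by move=> x _; rewrite lee_fin.
rewrite -sumEFin; apply: lee_sum => j _.
rewrite EFinM -(lebesgue_cube_rV (c j) km) -/(Q j) -(integral_cst _ (mQ j)).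
apply: ge0_le_integral => //.
- by move=> x _; rewrite lee_fin.
- move=> x /Qcube/wf; rewrite scalerA mulfV ?gt_eqF// scale1r addrC subrK lee_fin.
  by [].
Qed.

End lower_sums.

(** * Scaling back: small energy excludes blow-up *)

Section blowup.
Context {R : realType} {N : nat}.

Lemma locally_bounded_not_blowup (Omega : set 'rV[R]_N) (T : R)
    (u : R -> 'rV[R]_N -> R) (a : 'rV[R]_N) (d C : R) : 0 < d ->
  (forall (t : R) (x : 'rV[R]_N), 0 < t < T -> Omega x -> `|t - T| < d ->
    (forall i, `|x ord0 i - a ord0 i| < d) -> `|u t x| <= C) ->
  ~ blowup_point Omega T u a.
Proof.
move=> d0 H [_]; rewrite limf_esupE => infoo.
have : ((+oo : \bar R) <= C%:E)%E; last by [].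
rewrite -infoo; apply: ge_ereal_inf.
pose A := [set z : R * 'rV[R]_N | `|z.1 - T| < d /\ forall i, `|z.2 ord0 i - a ord0 i| < d].
pose B := [set z : R * 'rV[R]_N | 0 < z.1 < T /\ Omega z.2].
exists (ereal_sup ((fun z : R * 'rV[R]_N => `|u z.1 z.2|%:E) @` (A `&` B))).
  exists (A `&` B) => //; rewrite /= /within/=; apply/near_rVP; exists d => //.
apply: ge_ereal_sup => _ [[t x] [[/= tT xa] [/= tI Ox]] <-].
by rewrite lee_fin; exact: H.
Qed.

Lemma enorm_box (a : 'rV[R]_N) (k : R) (b : nat) : 0 <= k ->
  box a (k * b%:R) `<=` [set x | enorm (x - a) <= Num.sqrt N%:R * b%:R * k].
Proof.
move=> k0 x xa /=.
have H : 0 <= Num.sqrt N%:R * b%:R * k by rewrite !mulr_ge0// sqrtr_ge0.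
rewrite -[leRHS](ger0_norm H) -sqrtr_sqr ler_wsqrtr// !exprMn sqr_sqrtr// -mulrA.
rewrite mulr_natl -[N in _ *+ N]card_ord -sumr_const; apply: ler_sum => i _.
rewrite !mxE -exprMn (mulrC b%:R) -real_normK ?num_real// lerXn2r ?nnegrE//; first exact: (le_trans _ (xa i)).
Qed.

Lemma powR_half_natl (L : R) : 0 <= L -> L `^ (N%:R / 2) = Num.sqrt L ^+ N.
Proof.
move=> L0; rewrite mulrC powRrM powR12_sqrt// powR_mulrn// sqrtr_ge0//.
Qed.

Theorem small_energy_not_blowup (p M : R) : (0 < N)%N -> 1 < p -> 0 < M ->
  exists (eta : R) (b : nat), [/\ 0 < eta, (0 < b)%N &
  forall (Omega : set 'rV[R]_N) (u0 : 'rV[R]_N -> R) (T : R) (u : R -> 'rV[R]_N -> R),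
  open Omega -> classical_solution p Omega u0 T%:E u ->
  (forall t : R, 0 <= t < T ->
     (Linfty_norm Omega (u t) <= (M * (T - t) `^ (- (p - 1)^-1))%:E)%E) ->
  forall a, blowup_point Omega T u a -> forall t, 0 < t < T ->
    (eta%:E <= \int[lebesgue_rV N]_(x in Omega `&` box a (Num.sqrt (T - t) * b%:R))
         (`|u t x| `^ (N%:R * (p - 1) / 2))%:E)%E].
Proof.
move=> N0 p1 M0; have [eta [b [eta0 b0 H]]] := rescaled_epsilon_regularity N0 p1 M0.
exists eta, b; split => // Omega u0 T u oO sol typeI a blow t0 /andP[t00 t0T].
rewrite leNgt; apply/negP => small.
have p10 : 0 < p - 1 by rewrite subr_gt0.
have p0 : 0 < p by rewrite (lt_trans ltr01).
have pn : p - 1 != 0 by rewrite gt_eqF.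
pose q : R := N%:R * (p - 1) / 2.
have q0 : 0 < q by rewrite divr_gt0// mulr_gt0// ltr0n.
pose L := T - t0; have L0 : 0 < L by rewrite subr_gt0.
pose k := Num.sqrt L; have k0 : 0 < k by rewrite sqrtr_gt0.
have kL : k ^+ 2 = L by rewrite sqr_sqrtr// ltW.
(* The amplitude dictated by the equation. For the critical [q] it satisfies [l^q = k^N], the
   Jacobian of the dilation, which is why the integral is scale invariant. *)
pose l := L `^ (p - 1)^-1; have l0 : 0 < l by exact: powR_gt0.
have lp : l `^ p = l * L.
  by rewrite -mulr_powRB1 ?(ltW l0)// /l -powRrM mulVf// powRr1// ltW.
have lq : l `^ q = k ^+ N.
  rewrite /l -powRrM -powR_half_natl ?(ltW L0)//; congr (_ `^ _).
  by rewrite /q; field.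
pose V (t : R) : 'rV[R]_N -> R := u t \_ Omega.
have VE t x : Omega x -> V t x = u t x by move=> Ox; rewrite /V patchE mem_set.
have cV t : 0 < t < T -> continuous (V t).
  by move=> tI x; apply: jcont_slice; exact: (extension_jcont oO sol).
have Vbound t x : 0 < t < T -> `|V t x| <= M * (T - t) `^ (- (p - 1)^-1).
  move=> tI; apply: Linfty_norm_continuous; first exact: cV.
  by apply: typeI; case/andP: tI => /ltW -> ->.
pose U (s : R) y := l * `|V (t0 + L * s) (a + k *: y)|.
have sI s : 0 <= s < 1 -> 0 < t0 + L * s < T.
  move=> /andP[s0 s1]; have : L * s < L by rewrite gtr_pMr.
  have : 0 <= L * s by rewrite mulr_ge0// ltW.
  by rewrite /L => *; apply/andP; split; lra.
have [] := H U.
- move=> s y /sI sI'; apply: (@jcont_rescale _ _ (fun t x => `|V t x|)) => //.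
  by apply: jcont_norm; exact: (extension_jcont oO sol).
- move=> s y /andP[s0 s1]; rewrite /U pmulr_rgt0// => Upos.
  apply: (@subsolution_rescale _ _ _ (fun t x => `|V t x|)) => //.
  apply: (extension_subsolution oO p0 sol) => //; apply: sI.
  by rewrite (ltW s0).
- move=> s y sI'; rewrite /U mulr_ge0 ?(ltW l0)//=.
  have := Vbound (t0 + L * s) (a + k *: y) (sI _ sI'); rewrite -(ler_pM2l l0) => /le_trans; apply.
  have -> : T - (t0 + L * s) = L * (1 - s) by rewrite /L; ring.
  case/andP: sI' => s0 s1.
  have E : l * L `^ (- (p - 1)^-1) = 1 by rewrite powRN mulfV// gt_eqF.
  by rewrite powRM ?(ltW L0) ?subr_ge0 ?(ltW s1)// mulrCA (mulrA l) E mul1r.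
- move=> m w m0 w0 wU.
  have f_cont : continuous (fun x => `|V t0 x| `^ q).
    move=> x; apply: (@continuous_comp _ _ _ (V t0) (fun y : R => `|y| `^ q)).
      by apply: cV; rewrite t00.
    exact: continuous_norm_powR.
  have lq0 : 0 < l `^ q by exact: powR_gt0.
  have := lower_sum_le_integral (f := fun x => `|V t0 x| `^ q) (a := a) (k := k)
    (w := fun j => w j / l `^ q) f_cont (fun x => powR_ge0 _ _) k0 m0.
  have -> : \sum_j w j / l `^ q * (k / m%:R) ^+ N = \sum_j w j * m%:R^-1 ^+ N.
    apply: eq_bigr => j _; rewrite exprMn -lq mulrA divfK// gt_eqF//.
  move=> LS; rewrite -lee_fin; apply: (le_trans (LS _ _)).
  + by move=> j; rewrite divr_ge0// ltW.
  + move=> j x jx; rewrite ler_pdivrMr//; apply: (le_trans (wU j x jx)).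
    by rewrite /U mulr0 addr0 powRM ?(ltW l0)// mulrC.
  (* The extension vanishes outside [Omega] and [0^q = 0] because [q > 0], so the integrals over the
     box and over its part in [Omega] agree. *)
  apply: le_trans (ltW small); rewrite setIC integral_mkcondr.
  rewrite le_eqVlt; apply/orP; left; apply/eqP; apply: eq_integral => x _.
  rewrite patchE; case: ifPn => [|xO]; first by rewrite inE => Ox; rewrite VE.
  by rewrite /V patchE (negPf xO) normr0 powR0// gt_eqF.
move=> r [C [r0 UC]].
(* Times within [L / 2] of [T] are those with rescaled time above 1/2, and [k r] is the rescaled
   [r]. *)
apply: (@locally_bounded_not_blowup Omega T u a (Num.min (L / 2) (k * r)) (C / l)) blow.
  by rewrite lt_min divr_gt0// mulr_gt0.
move=> t x tI Ox; rewrite lt_min => /andP[tT _] xa.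
rewrite ler_pdivlMr// mulrC.
have := UC ((t - t0) / L) (k^-1 *: (x - a)).
have tE : t0 + L * ((t - t0) / L) = t by field; rewrite gt_eqF.
have xE : a + k *: (k^-1 *: (x - a)) = x.
  by rewrite scalerA mulfV ?gt_eqF// scale1r addrC subrK.
rewrite /U tE xE VE//; apply.
  move: tT tI; rewrite ltr_norml ler_pdivlMr// ltr_pdivrMr// /L => /andP[A _] /andP[_ B].
  by apply/andP; split; lra.
move=> i; rewrite !mxE subr0 normrM gtr0_norm ?invr_gt0// mulrC ler_pdivrMr//.
by have := xa i; rewrite lt_min => /andP[_ ?]; rewrite mulrC ltW.
Qed.

End blowup.

(** * Passage to the initial time *)

Section initial_time.
Context {R : realType} {N : nat}.

Lemma enormE (a x : 'rV[R]_N) : enorm (x - a) = Num.sqrt (sqdist a x).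
Proof. by rewrite /enorm /sqdist; congr Num.sqrt; apply: eq_bigr => i _; rewrite !mxE. Qed.

Lemma measurable_enorm_ball (a : 'rV[R]_N) (c : R) :
  measurable [set x : 'rV[R]_N | enorm (x - a) <= c].
Proof.
have m : measurable_fun setT (fun x : 'rV[R]_N => Num.sqrt (sqdist a x)).
  apply: continuous_measurable_rV => x.
  apply: (@continuous_comp _ _ _ (sqdist a) (@Num.sqrt R)); first exact: sqdist_continuous.
  exact: sqrt_continuous.
have := m measurableT [set` `]-oo, c]] (measurable_itv _).
rewrite setTI; congr (measurable _); apply/seteqP.
by split => x /=; rewrite in_itv/= enormE.
Qed.

Lemma enorm_ball_sub_box (a : 'rV[R]_N) (c : R) :
  [set x : 'rV[R]_N | enorm (x - a) <= c] `<=` box a c.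
Proof.
move=> x /= xc i; apply: le_trans xc; rewrite enormE.
by rewrite -sqrtr_sqr ler_wsqrtr// sqdist_coord.
Qed.

Lemma lebesgue_box_lty (a : 'rV[R]_N) (c : R) : (lebesgue_rV N (box a c) < +oo)%E.
Proof.
pose a' : 'rV[R]_N := \row_i (a ord0 i - `|c|).
have h0 : 0 <= 2 * `|c| + 1 :> R by rewrite addr_ge0// mulr_ge0.
apply: (@le_lt_trans _ _ ((2 * `|c| + 1) ^+ N)%:E); last exact: ltry.
rewrite -(lebesgue_cube_rV a' h0); apply: le_measure; rewrite ?inE.
- exact: measurable_box.
- exact: measurable_cube_rV.
move=> x xc i; rewrite !mxE; have := le_trans (xc i) (ler_norm c).
by rewrite ler_norml => /andP[? ?]; apply/andP; split; lra.
Qed.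

(** Needed because convergence to the datum is stated on balls centred at the origin only. *)
Lemma enorm_ball_sub_ball0 (a : 'rV[R]_N) (c : R) : exists r : R,
  [set x : 'rV[R]_N | enorm (x - a) <= c] `<=` [set x | enorm x <= r].
Proof.
exists (Num.sqrt (\sum_i (2 * c ^+ 2 + 2 * a ord0 i ^+ 2))) => x /enorm_ball_sub_box xc.
rewrite /enorm /= ler_wsqrtr//; apply: ler_sum => i _.
have : (x ord0 i - a ord0 i) ^+ 2 <= c ^+ 2.
  rewrite -real_normK ?num_real// lerXn2r ?nnegrE//.
  exact: le_trans (xc i).
have := sqr_ge0 (x ord0 i - 2 * a ord0 i).
move: (x ord0 i) (a ord0 i) => y z; rewrite !expr2 => *; nra.
Qed.

(** A single small time suffices: integrating [|u t|^q <= |u 0|^q + d + C |u t - u 0|] over [D]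
    costs at most [eta / 4] for [d] and [eta / 8] for the last term. *)
Lemma L1loc_energy_limit (p M eta c : R) (Omega : set 'rV[R]_N) (u0 : 'rV[R]_N -> R)
    (T : R) (u : R -> 'rV[R]_N -> R) (a : 'rV[R]_N) (q : R) :
  0 < q -> 0 < eta -> open Omega -> 0 < T -> Linfty Omega u0 ->
  classical_solution p Omega u0 T%:E u ->
  (forall t x, 0 < t <= T / 2 -> Omega x -> `|u t x| <= M) ->
  let D := Omega `&` [set x | enorm (x - a) <= c] in
  (forall t, 0 < t < T -> (eta%:E <= \int[lebesgue_rV N]_(x in D) (`|u t x| `^ q)%:E)%E) ->
  ((eta / 2)%:E <= \int[lebesgue_rV N]_(x in D) (`|u 0 x| `^ q)%:E)%E.
Proof.
move=> q0 eta0 oO T0 Lu0 sol uM D Hpos.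
have mD : measurable D.
  by apply: measurableI; [exact: open_measurable_rV|exact: measurable_enorm_ball].
have DO x : D x -> Omega x by case.
have mO : measurable Omega by exact: open_measurable_rV.
have mutO t : 0 <= t < T -> measurable_fun Omega (u t).
  move=> /andP[t0 tT]; apply: (eq_measurable_fun (u t \_ Omega)).
    by move=> x xO; rewrite patchE xO.
  apply: measurable_funTS; move: t0; rewrite le_eqVlt => /orP[/eqP<-|t0].
    (* At time [0] there is no continuity to rely on; measurability is inherited from the datum. *)
    have -> : u 0 \_ Omega = u0 \_ Omega.
      apply/funext => x; rewrite !patchE; case: ifPn => //; rewrite inE => Ox.
      exact: (cs_initial sol).
    by move: Lu0 => /sub_Lfun_mfun; rewrite inE.
  apply: continuous_measurable_rV => x.
  apply: (@jcont_slice _ _ (fun t => u t \_ Omega)).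

  by apply: (extension_jcont oO sol); rewrite t0.
have mut t : 0 <= t < T -> measurable_fun D (u t).
  by move=> tI; apply: measurable_funS (mutO t tI) => // x /DO.
have muq t : 0 <= t < T -> measurable_fun D (fun x => (`|u t x| `^ q)%:E).
  move=> tI; apply/measurable_EFinP.
  apply: (measurableT_comp (f := fun y : R => `|y| `^ q)); last exact: mut.
  apply: measurable_realfun.continuous_measurable_fun.
  exact: continuous_norm_powR.
have Dfin : (lebesgue_rV N D < +oo)%E.
  apply: le_lt_trans (lebesgue_box_lty a c); apply: le_measure; rewrite ?inE//.
    exact: measurable_box.
  by move=> x [_ /enorm_ball_sub_box].
pose m := fine (lebesgue_rV N D).
have mE : lebesgue_rV N D = m%:E by rewrite fineK// ge0_fin_numE.
have m0 : 0 <= m by rewrite fine_ge0.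
(* Dividing by [m + 1] allows [D] to be null and still keeps the error over [D] below [eta / 4]. *)
have d0 : 0 < eta / (4 * (m + 1)) by rewrite divr_gt0// mulr_gt0// ltr_wpDl.
have [C C0 HC] := powR_diff_bound M q0 d0.
have eC0 : 0 < eta / (8 * C) by rewrite divr_gt0// mulr_gt0.
have [r Dr] := enorm_ball_sub_ball0 a c.
have L1 := cs_initial_L1loc sol r.
have L1e : \forall t \near 0^'+, (\int[lebesgue_rV N]_(x in Omega `&`
    [set x | (enorm x <= r)%R]) `|u t x - u0 x|%:E < (eta / (8 * C))%:E)%E.
  apply: (L1 [set y : \bar R | (y < (eta / (8 * C))%:E)%E]).
  by apply: open_ereal_lt'; rewrite lte_fin.
have [t [tI tL1]] : exists t : R, 0 < t <= T / 2 /\ (\int[lebesgue_rV N]_(x in Omega `&`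
    [set x | (enorm x <= r)%R]) `|u t x - u0 x|%:E < (eta / (8 * C))%:E)%E.
  near (0 : R)^'+ => t; exists t; split; last by near: t.
  apply/andP; split; first by near: t; exact: nbhs_right_gt.
  by near: t; apply: nbhs_right_le; rewrite divr_gt0.
have tT : 0 < t < T by case/andP: tI => *; apply/andP; split; lra.
have t0T : 0 <= t < T by case/andP: tT => /ltW -> ->.
have zT : 0 <= (0 : R) < T by rewrite lexx.
have mdiff : measurable_fun D (fun x => `|u t x - u 0 x|%:E).
  apply/measurable_EFinP; apply: measurableT_comp; first exact: normr_measurable.
  by apply: measurable_funB; exact: mut.
have diff : (\int[lebesgue_rV N]_(x in D) `|u t x - u 0 x|%:E <= (eta / (8 * C))%:E)%E.
  apply: le_trans (ltW tL1).
  rewrite [leRHS](eq_integral (fun x => `|u t x - u 0 x|%:E)); last first.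
    by move=> x; rewrite inE => -[Ox _]; rewrite (cs_initial sol).
  apply: ge0_subset_integral => //.
  - apply: measurableI => //; have := measurable_enorm_ball 0 r.
    by under eq_set do rewrite subr0.
  - apply/measurable_EFinP; apply: measurableT_comp; first exact: normr_measurable.
    by apply: measurable_funB; apply: measurable_funS (mutO _ _) => //; exact: subIsetl.
  - by move=> x [Ox xc]; split => //; exact: Dr.
rewrite leNgt; apply/negP => small.
have := Hpos t tT; apply/negP; rewrite -ltNge.
apply: (@le_lt_trans _ _ (\int[lebesgue_rV N]_(x in D)
   ((`|u 0 x| `^ q)%:E + ((eta / (4 * (m + 1)))%:E + C%:E * `|u t x - u 0 x|%:E)))%E).
  apply: ge0_le_integral => //.
  - exact: muq.
  - apply: emeasurable_funD; first exact: muq.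
    by apply: emeasurable_funD => //; exact: measurable_funeM.
  - move=> x /DO Ox; rewrite -EFinM -!EFinD lee_fin addrA.
    by apply: HC; exact: uM.
rewrite ge0_integralD//; last 3 first.
- exact: muq.
- by move=> x _; rewrite -EFinM -EFinD lee_fin addr_ge0 ?(ltW d0)// mulr_ge0// ltW.
- by apply: emeasurable_funD => //; exact: measurable_funeM.
rewrite ge0_integralD//; last 3 first.
- by move=> x _; rewrite lee_fin ltW.
- by move=> x _; rewrite -EFinM lee_fin mulr_ge0// ltW.
- exact: measurable_funeM.
have -> : (\int[lebesgue_rV N]_(x in D) (eta / (4 * (m + 1)))%:E =
    (eta / (4 * (m + 1)))%:E * m%:E)%E.
  rewrite (integral_cst _ mD); congr (_ * _)%E; exact: mE.
rewrite ge0_integralZl//; last first.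
  by rewrite lee_fin ltW.
have A : ((eta / (4 * (m + 1)))%:E * m%:E + C%:E * \int[lebesgue_rV N]_(x in D) `|u t x - u 0 x|%:E
   <= (eta / 2)%:E)%E.
  have -> : eta / 2 = eta / 4 + eta / 4 by field.
  rewrite EFinD; apply: leeD.
    rewrite -EFinM lee_fin; have -> : eta / (4 * (m + 1)) * m = eta / 4 * (m / (m + 1)).
      by field; rewrite gt_eqF// ltr_wpDl.
    by rewrite ger_pMr ?divr_gt0// ler_pdivrMr ?ltr_wpDl// mul1r lerDl.
  apply: (@le_trans _ _ (C%:E * (eta / (8 * C))%:E)%E).
    by apply: lee_wpmul2l => //; rewrite lee_fin ltW.
  rewrite -EFinM lee_fin; have -> : C * (eta / (8 * C)) = eta / 8 by field; rewrite gt_eqF.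
  by lra.
rewrite [X in (_ < X%:E)%E](_ : eta = eta / 2 + eta / 2); last by field.
by apply: le_lt_trans (leeD (lexx _) A) _; rewrite EFinD lteD2rE.
Unshelve. all: by end_near.
Qed.

End initial_time.

Theorem lemma3p1 (R : realType) (N : nat) (p M : R) :
  (1 <= N)%N -> 1 < p -> 0 < M ->
  exists eta1 k1 : R, [/\ 0 < eta1, 0 < k1 &
    forall (Omega : set 'rV[R]_N) (u0 : 'rV[R]_N -> R) (T : R)
      (u : R -> 'rV[R]_N -> R),
    domain Omega -> smooth_boundary Omega ->
    Linfty Omega u0 ->
    maximal_classical_solution p Omega u0 T%:E u ->
    (forall t : R, 0 <= t < T ->
       (Linfty_norm Omega (u t) <= (M * (T - t) `^ (- (p - 1)^-1))%:E)%E) ->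
    forall a, blowup_point Omega T u a ->
    forall t : R, 0 <= t < T ->
      (eta1%:E <=
       \int[lebesgue_rV N]_(x in Omega `&`
                               [set x | (enorm (x - a) <= k1 * Num.sqrt (T - t))%R])
         (`|u t x| `^ (N%:R * (p - 1) / 2))%:E)%E].
Proof.
move=> N0 p1 M0.
have [eta [b [eta0 b0 small]]] := small_energy_not_blowup N0 p1 M0.
have p10 : 0 < p - 1 by rewrite subr_gt0.
pose q : R := N%:R * (p - 1) / 2.
have q0 : 0 < q by rewrite divr_gt0// mulr_gt0// ltr0n.
(* The energy bound lives on cubes of half-side [b * sqrt (T - t)]; the circumscribed Euclidean ball
   costs the factor [sqrt N]. *)
pose k1 : R := Num.sqrt N%:R * b%:R.
have k10 : 0 < k1 by rewrite mulr_gt0 ?sqrtr_gt0 ?ltr0n.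
exists (eta / 2), k1; split => //; first by rewrite divr_gt0.
move=> Omega u0 T u [oO _ _] _ Lu0 [sol _] typeI a blow.
have T0 : 0 < T by have := cs_T sol; rewrite lte_fin.
have cV t : 0 < t < T -> continuous (u t \_ Omega).
  by move=> tI x; apply: (@jcont_slice _ _ (fun t => u t \_ Omega)); exact: (extension_jcont oO sol).
have mb (c : R) : measurable (Omega `&` [set x | enorm (x - a) <= c]).
  by apply: measurableI; [exact: open_measurable_rV|exact: measurable_enorm_ball].
have pos (c t : R) : 0 < t < T -> k1 * Num.sqrt (T - t) <= c ->
    (eta%:E <= \int[lebesgue_rV N]_(x in Omega `&` [set x | (enorm (x - a) <= c)%R])
      (`|u t x| `^ q)%:E)%E.
  move=> tI kc; apply: le_trans (small _ _ _ _ oO sol typeI a blow t tI) _.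
  apply: ge0_subset_integral => //.
  - by apply: measurableI; [exact: open_measurable_rV|exact: measurable_box].
  - apply/measurable_EFinP; apply: (eq_measurable_fun (fun x => `|(u t \_ Omega) x| `^ q)).
      by move=> x; rewrite inE => -[Ox _]; rewrite patchE mem_set.
    apply: measurable_funTS; apply: continuous_measurable_rV => x.
    apply: (@continuous_comp _ _ _ (u t \_ Omega) (fun y : R => `|y| `^ q)); first exact: cV.
    exact: continuous_norm_powR.
  - move=> x [Ox xb]; split => //; apply: le_trans kc.
    exact: enorm_box xb.
move=> t /andP[]; rewrite le_eqVlt => /orP[/eqP<-|t0] tT; last first.
  apply: (@le_trans _ _ eta%:E); last by apply: pos => //; rewrite t0.
  by rewrite lee_fin; lra.
(* Up to time [T / 2] the type I rate is at most its value there. The balls for positive times all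
   lie in the one for time [0], so the limit is taken over a fixed set. *)
apply: (@L1loc_energy_limit R N p (M * (T / 2) `^ (- (p - 1)^-1)) eta _ Omega u0 T u a q) => //.
  move=> s x /andP[s0 sT] Ox.
  have sI : 0 < s < T by rewrite s0 /=; lra.
  have := Linfty_norm_continuous (cV s sI) (typeI s _) x.
  rewrite patchE mem_set// => H; apply: le_trans (H _) _.
    by case/andP: sI => /ltW -> ->.
  rewrite ler_pM2l// !powRN lef_pV2 ?posrE ?powR_gt0//; [|lra|lra].
  by apply: ge0_ler_powR; rewrite ?nnegrE ?invr_ge0 ?(ltW p10)//; lra.
move=> s sI; apply: pos => //.
rewrite ler_pM2l// ler_wsqrtr//; case/andP: sI => *; lra.
Qed.
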